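(* Let $(\Gamma_1, v_1, w_1)$ and $(\Gamma_2, v_2, w_2)$ be twice-marked graphs with vertex gluing $(\Gamma, v_1, w_2)$. For any divisor $D = D_1 + D_2$ on $\Gamma$, with $D_i$ supported on $\Gamma_i$ for $i = 1,2$, $$s^{v_1, w_2}_D = s^{v_1, w_1}_{D_1} \star s^{v_2, w_2}_{D_2}.$$ In particular, if $D_1$, $D_2$ and $D$ are submodular (with respect to $v_1,w_1$ on $\Gamma_1$; $v_2,w_2$ on $\Gamma_2$; and $v_1,w_2$ on $\Gamma$, respectively), then $$\tau^{v_1, w_2}_D = \tau^{v_1, w_1}_{D_1} \star \tau^{v_2, w_2}_{D_2}.$$ In both equations, the terms involving $D_i$ refer to $D_i$ as a divisor on $\Gamma_i$.
   Context: Graphs. The word ''graph'' means either a connected metric graph, or a finite connected graph (parallel edges allowed) with no loop edges; ''points'' are all points of a metric graph, respectively the vertices of a finite graph. A divisor is a $\mathbb{Z}$-linear combination of points; it is effective if all coefficients are nonnegative. Linear equivalence $\sim$ is the usual one (chip-firing for finite graphs; differing by the divisor of a continuous piecewise-linear function with integer slopes for metric graphs). $r(D)$ is the Baker--Norine rank: $r(D) = -1$ if $D$ is not equivalent to an effective divisor, and otherwise $r(D)$ is the largest $r \ge 0$ such that $D - E$ is equivalent to an effective divisor for every effective $E$ of degree $r$. $K_\Gamma=\sum_p (\mathrm{val}(p)-2)p$ is the canonical divisor. A twice-marked graph $(\Gamma, v, w)$ is a graph with two chosen points. Vertex gluing. The vertex gluing of $(\Gamma_1, v_1, w_1)$ and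 $(\Gamma_2, v_2, w_2)$ (both finite or both metric) is $(\Gamma, v_1, w_2)$, where $\Gamma$ is obtained from the disjoint union of $\Gamma_1$ and $\Gamma_2$ by identifying $w_1$ with $v_2$. Transmission function. $\mathbb{N}$ denotes the nonnegative integers. The transmission function of a divisor $D$ on $(\Gamma, v, w)$ is $s^{v,w}_D : \mathbb{Z}^2 \to \mathbb{N}$, $s^{v,w}_D(a,b) = r(D + (a-1)v - bw) + 1$. Submodularity. For a divisor $D$ on $(\Gamma, v, w)$ put $\Delta(D) = r(D) - r(D-v) - r(D-w) + r(D-v-w)$. $D$ is submodular (with respect to $v,w$) if $\Delta(D + av - bw) \geq 0$ for all $a,b \in \mathbb{Z}$. Transmission permutation. The transmission permutation of $D$ on $(\Gamma, v, w)$, if it exists, is the unique permutation $\tau^{v,w}_D : \mathbb{Z} \to \mathbb{Z}$ such that the following two (equivalent) equations hold for all $a, b \in \mathbb{Z}$: $r(D + av - bw) + 1 = \#\{ n \geq b : \tau^{v,w}_D(n) \leq a\}$ and $r(K_\Gamma - D - av + bw) + 1 = \#\{ n < b : \tau^{v,w}_D(n) > a \}$. It exists exactly when $D$ is submodular. Demazure product. For functions $s_1, s_2 : \mathbb{Z}^2 \to \mathbb{N}$, define $(s_1 \star s_2)(a,b) = \min_{\ell \in \mathbb{Z}} \big(s_1(a,\ell) + s_2(\ell,b)\big)$. For a permutation $\tau$ of $\mathbb{Z}$ put $s_\tau(a,b) = \#\{n \geq b : \tau(n) < a\}$; $\tau$ is almost-sign-preserving if $s_\tau(0,0)$ and $s_{\tau^{-1}}(0,0)$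 are finite (equivalently, $s_\tau(a,b)$ and $s_{\tau^{-1}}(a,b)$ are finite for all $a,b$). For almost-sign-preserving $\alpha,\beta$, the Demazure product $\alpha \star \beta$, if it exists, is the unique almost-sign-preserving permutation with $s_{\alpha\star\beta} = s_\alpha \star s_\beta$. *)

(* Defs.v *)
From HB Require Import structures.
From mathcomp Require Import all_boot all_order all_algebra finmap.
From mathcomp Require Import boolp classical_sets functions cardinality reals.
From mathcomp Require Import freeg.

Set Implicit Arguments.
Unset Strict Implicit.
Unset Printing Implicit Defensive.

Import Order.TTheory GRing.Theory Num.Theory.

Local Open Scope classical_set_scope.
Local Open Scope ring_scope.

(* The orientation of the edges from [tail] to [head] is only a bookkeeping
   device: no notion below depends on it. *)
Record multigraph := Multigraph {
  vertex : finType;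
  edge : finType;
  tail : edge -> vertex;
  head : edge -> vertex }.

Definition adjacent (G : multigraph) : rel (vertex G) := [rel x y |
  [exists e, (tail e == x) && (head e == y) || (tail e == y) && (head e == x)]].

Definition connected_graph (G : multigraph) : Prop :=
  forall x y : vertex G, connect (@adjacent G) x y.

(* A loop contributes 2. *)
Definition val (G : multigraph) (v : vertex G) : nat :=
  (#|[pred e | @tail G e == v]| + #|[pred e | @head G e == v]|)%N.

(* The disjoint union of [G1] and [G2] with [v2] identified to [w1]; the vertex
   obtained by the identification is represented by [inl w1]. *)
Section VertexGluing.
Variables (G1 G2 : multigraph) (w1 : vertex G1) (v2 : vertex G2).

Definition glue_vertex : finType :=
  (vertex G1 + {x : vertex G2 | x != v2})%type.

Definition glue_vertex_r (x : vertex G2) : glue_vertex :=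
  if insub x is Some y then inr y else inl w1.

Definition mg_glue : multigraph :=
  @Multigraph glue_vertex (edge G1 + edge G2)%type
    (fun e => match e with inl e1 => inl (tail e1)
                         | inr e2 => glue_vertex_r (tail e2) end)
    (fun e => match e with inl e1 => inl (head e1)
                         | inr e2 => glue_vertex_r (head e2) end).

Lemma glue_vertex_r_inj : injective glue_vertex_r.
Proof.
rewrite /glue_vertex_r => x y; case: insubP => [x' _ <-|]; last first.
  by move/negPn/eqP=> ->; case: insubP => // /negPn/eqP ->.
by case: insubP => [y' _ <- [->]|].
Qed.

Lemma mg_glue_connected :
  connected_graph G1 -> connected_graph G2 -> connected_graph mg_glue.
Proof.
move=> c1 c2.
have adjC (G : multigraph) : symmetric (@adjacent G).
  by move=> a b; apply: eq_existsb => e; rewrite orbC.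
have L x : connect (@adjacent mg_glue) (inl x) (inl w1).
  have /connectP[p] := c1 x w1; elim: p x => [|y p IH] x /=.
    by move=> _ ->.
  move=> /andP[/existsP[e he]] pp ew; apply: connect_trans (IH _ pp ew).
  by apply/connect1/existsP; exists (inl e).
have R x : connect (@adjacent mg_glue) (glue_vertex_r x) (inl w1).
  have -> : inl w1 = glue_vertex_r v2.
    by rewrite /glue_vertex_r; case: insubP => //= y; rewrite eqxx.
  have /connectP[p] := c2 x v2; elim: p x => [|y p IH] x /=.
    by move=> _ ->.
  move=> /andP[/existsP[e he]] pp ew; apply: connect_trans (IH _ pp ew).
  by apply/connect1/existsP; exists (inr e); rewrite /= !(inj_eq glue_vertex_r_inj).
have A x : connect (@adjacent mg_glue) x (inl w1).
  case: x => [x|x]; first exact: L.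
  have -> : inr x = glue_vertex_r (\val x).
    by rewrite /glue_vertex_r valK.
  exact: R.
move=> x y; apply: (connect_trans (A x)).
by rewrite (sym_connect_sym (adjC mg_glue)).
Qed.

End VertexGluing.

Record fgraph := FGraph {
  fgraph_mg :> multigraph;
  fgraph_connected : connected_graph fgraph_mg;
  fgraph_loopless : forall e : edge fgraph_mg, tail e != head e }.

(* [laplacian f v] is the number of chips gained by [v] when every vertex [u]
   fires [f u] times. *)
Definition laplacian (G : fgraph) (f : vertex G -> int) (v : vertex G) : int :=
  \sum_(e : edge G | tail e == v) (f (head e) - f v)
  + \sum_(e : edge G | head e == v) (f (tail e) - f v).

Definition fprincipal (G : fgraph) (D : {freeg (vertex G) / int}) : Prop :=
  exists f : vertex G -> int, forall v, coeff v D = laplacian f v.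

Definition fcanonical (G : fgraph) : {freeg (vertex G) / int} :=
  \sum_(v : vertex G) << (val v)%:Z - 2 *g v >>.

Lemma fglue_loopless (G1 G2 : fgraph) (w1 : vertex G1) (v2 : vertex G2)
  (e : edge (mg_glue w1 v2)) : tail e != head e.
Proof.
case: e => e /=; first exact: (fgraph_loopless e).
by rewrite (inj_eq (@glue_vertex_r_inj _ _ _ _)) (fgraph_loopless e).
Qed.

Definition fglue (G1 G2 : fgraph) (w1 : vertex G1) (v2 : vertex G2) : fgraph :=
  FGraph (@mg_glue_connected _ _ w1 v2 (@fgraph_connected G1) (@fgraph_connected G2))
         (@fglue_loopless G1 G2 w1 v2).

(* A model of a metric graph: a connected finite multigraph (loops
   allowed) together with a positive length for each edge. *)
Record mgraph (R : realType) := MGraph {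
  mgraph_mg :> multigraph;
  len : edge mgraph_mg -> R;
  mgraph_connected : connected_graph mgraph_mg;
  len_gt0 : forall e, 0 < len e }.

Section MetricGraph.
Variables (R : realType).

(* Points are the vertices of the model together with the interior points of the
   edges: [(e, t)] is the point of the edge [e] at distance [t] from [tail e]. *)
Definition mpoint (G : mgraph R) : choiceType :=
  (vertex G + {x : edge G * R | 0 < x.2 < len x.1})%type.

(* The parametrization of the closed edge [e] by [0 <= t <= len e]. *)
Definition pt (G : mgraph R) (e : edge G) (t : R) : mpoint G :=
  if insub (e, t) is Some x then inr x
  else inl (if t <= 0 then tail e else head e).

(* [g] is continuous and piecewise linear with integer slopes on [0, l]: it is
   affine on every closed subinterval whose interior avoids the finite set
   [bps] of breakpoints. *)
Definition pl_integer_slopes (l : R) (g : R -> R) : Prop :=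
  exists bps : seq R, forall a b : R, 0 <= a -> a <= b -> b <= l ->
    (forall c, c \in bps -> ~~ (a < c < b)) ->
    exists m : int, forall x, a <= x <= b -> g x = g a + m%:~R * (x - a).

Definition rational_function (G : mgraph R) (f : mpoint G -> R) : Prop :=
  forall e : edge G, pl_integer_slopes (len e) (fun t => f (pt e t)).

(* One-sided slopes of [g] at [t], in the direction of increasing, respectively
   decreasing, parameter (so both are outgoing slopes). *)
Definition slope_up (g : R -> R) (t : R) : int :=
  xget 0 [set m : int | exists2 eps : R, 0 < eps &
    forall h, 0 <= h <= eps -> g (t + h) = g t + m%:~R * h].

Definition slope_down (g : R -> R) (t : R) : int :=
  slope_up (fun u => g (- u)) (- t).

Definition ord_at (G : mgraph R) (f : mpoint G -> R) (p : mpoint G) : int :=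
  match p with
  | inl v => \sum_(e : edge G | tail e == v) slope_up (fun t => f (pt e t)) 0
           + \sum_(e : edge G | head e == v)
               slope_down (fun t => f (pt e t)) (len e)
  | inr x => let: (e, t) := \val x in
             slope_up (fun t => f (pt e t)) t
             + slope_down (fun t => f (pt e t)) t
  end.

Definition mprincipal (G : mgraph R) (D : {freeg (mpoint G) / int}) : Prop :=
  exists2 f : mpoint G -> R, rational_function f &
    forall p, coeff p D = ord_at f p.

(* Points in the interior of an edge have valence 2 and do not contribute. *)
Definition mcanonical (G : mgraph R) : {freeg (mpoint G) / int} :=
  \sum_(v : vertex G) << (val v)%:Z - 2 *g (inl v : mpoint G) >>.

(* Subdivision of a model at an interior point [(e, t)] of an edge: the point
    becomes the vertex [None], the edge [e] is shortened to the part before it,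
    and the new edge [None] is the part after it. *)
Section Subdivision.
Variables (G : mgraph R) (e : edge G) (t : R).

Definition subdiv_mg : multigraph :=
  @Multigraph (option (vertex G)) (option (edge G))
    (fun e' => if e' is Some e1 then Some (tail e1) else None)
    (fun e' => if e' is Some e1 then
                 if e1 == e then None else Some (head e1)
               else Some (head e)).

Definition subdiv_len (e' : edge subdiv_mg) : R :=
  if e' is Some e1 then if e1 == e then t else len e1 else len e - t.

Lemma subdiv_connected : connected_graph subdiv_mg.
Proof.
have adjC (H : multigraph) : symmetric (@adjacent H).
  by move=> a b; apply: eq_existsb => e'; rewrite orbC.
have cC := sym_connect_sym (adjC subdiv_mg).
have T : connect (@adjacent subdiv_mg) (Some (tail e)) None.
  by apply/connect1/existsP; exists (Some e); rewrite /= !eqxx.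
have H : connect (@adjacent subdiv_mg) None (Some (head e)).
  by apply/connect1/existsP; exists None; rewrite /= !eqxx.
have E e' : connect (@adjacent subdiv_mg) (Some (tail e')) (Some (head e')).
  have [->|ne] := eqVneq e' e; first exact: connect_trans T H.
  by apply/connect1/existsP; exists (Some e'); rewrite /= (negPf ne) !eqxx.
have S x y : connect (@adjacent subdiv_mg) (Some x) (Some y).
  have /connectP[p] := @mgraph_connected _ G x y.
  elim: p x => [|z p IH] x /=; first by move=> _ ->.
  move=> /andP[/existsP[e' he]] pp ew; apply: connect_trans (IH _ pp ew).
  case/orP: he => /andP[/eqP<- /eqP<-]; first exact: E.
  by rewrite cC; exact: E.
case=> [x|] [y|] //; rewrite ?connect0 //.
  exact: connect_trans (S _ _) T.
by rewrite cC; exact: connect_trans (S _ _) T.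
Qed.

Hypothesis ht : 0 < t < len e.

Lemma subdiv_len_gt0 (e' : edge subdiv_mg) : 0 < subdiv_len e'.
Proof.
case/andP: ht => t0 tl; case: e' => [e'|] /=; last by rewrite subr_gt0.
by case: ifP => // _; exact: len_gt0.
Qed.

Definition subdiv : mgraph R :=
  @MGraph R subdiv_mg subdiv_len subdiv_connected subdiv_len_gt0.

Definition subdiv_point (p : mpoint G) : mpoint subdiv :=
  match p with
  | inl v => inl (Some v)
  | inr x => let: (e', u) := \val x in
             if e' == e then
               if u <= t then @pt subdiv (Some e) u
               else @pt subdiv None (u - t)
             else @pt subdiv (Some e') u
  end.

End Subdivision.

(* [model_at p] is a model of the same metric graph in which [p] is a vertex,
   namely [vertex_at p]; [to_model_at p] identifies the points of the two
   models. *)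
Definition model_at (G : mgraph R) (p : mpoint G) : mgraph R :=
  match p with
  | inl _ => G
  | inr (exist _ ht) => subdiv ht
  end.

Definition vertex_at (G : mgraph R) (p : mpoint G) : vertex (model_at p) :=
  match p with
  | inl v => v
  | inr (exist _ _) => None
  end.

Definition to_model_at (G : mgraph R) (p : mpoint G) :
    mpoint G -> mpoint (model_at p) :=
  match p with
  | inl _ => id
  | inr (exist _ ht) => subdiv_point ht
  end.

Section MetricVertexGluing.
Variables (G1 G2 : mgraph R) (w1 : vertex G1) (v2 : vertex G2).

Definition mvglue_len (e : edge (mg_glue w1 v2)) : R :=
  match e with inl e1 => len e1 | inr e2 => len e2 end.

Lemma mvglue_len_gt0 e : 0 < mvglue_len e.
Proof. by case: e => e; exact: len_gt0. Qed.

Definition mvglue : mgraph R :=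
  MGraph
    (@mg_glue_connected _ _ w1 v2 (@mgraph_connected _ G1) (@mgraph_connected _ G2))
    mvglue_len_gt0.

Definition mvglue_inl (p : mpoint G1) : mpoint mvglue :=
  match p with
  | inl v => inl (inl v)
  | inr x => @pt mvglue (inl (\val x).1) (\val x).2
  end.

Definition mvglue_inr (p : mpoint G2) : mpoint mvglue :=
  match p with
  | inl v => inl (glue_vertex_r w1 v2 v)
  | inr x => @pt mvglue (inr (\val x).1) (\val x).2
  end.

End MetricVertexGluing.

Section MetricGluing.
Variables (G1 G2 : mgraph R) (w1 : mpoint G1) (v2 : mpoint G2).

Definition mglue : mgraph R := mvglue (vertex_at w1) (vertex_at v2).

Definition mglue_inl (p : mpoint G1) : mpoint mglue :=
  mvglue_inl _ _ (to_model_at w1 p).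

Definition mglue_inr (p : mpoint G2) : mpoint mglue :=
  mvglue_inr _ _ (to_model_at v2 p).

End MetricGluing.

End MetricGraph.

Inductive graph_kind := Finite | Metric of realType.

Definition graph (k : graph_kind) : Type :=
  match k with Finite => fgraph | Metric R => mgraph R end.

Definition points (k : graph_kind) : graph k -> choiceType :=
  match k with
  | Finite => fun G => vertex G
  | Metric R => fun G => mpoint G
  end.

Definition divisor (k : graph_kind) (G : graph k) : zmodType :=
  {freeg (points G) / int}.

Definition principal (k : graph_kind) :
    forall G : graph k, divisor G -> Prop :=
  match k with
  | Finite => fun G D => @fprincipal G D
  | Metric R => fun G D => @mprincipal R G D
  end.

Definition canonical (k : graph_kind) : forall G : graph k, divisor G :=
  match k with
  | Finite => fun G => fcanonical G
  | Metric R => fun G => mcanonical G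
  end.

Definition glue (k : graph_kind) : forall G1 G2 : graph k,
    points G1 -> points G2 -> graph k :=
  match k with
  | Finite => fun G1 G2 w1 v2 => @fglue G1 G2 w1 v2
  | Metric R => fun G1 G2 w1 v2 => @mglue R G1 G2 w1 v2
  end.

Definition glue_inl (k : graph_kind) : forall (G1 G2 : graph k)
    (w1 : points G1) (v2 : points G2), points G1 -> points (glue w1 v2) :=
  match k with
  | Finite => fun G1 G2 w1 v2 p => inl p
  | Metric R => fun G1 G2 w1 v2 p => @mglue_inl R G1 G2 w1 v2 p
  end.

Definition glue_inr (k : graph_kind) : forall (G1 G2 : graph k)
    (w1 : points G1) (v2 : points G2), points G2 -> points (glue w1 v2) :=
  match k with
  | Finite => fun G1 G2 w1 v2 p => @glue_vertex_r G1 G2 w1 v2 p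
  | Metric R => fun G1 G2 w1 v2 p => @mglue_inr R G1 G2 w1 v2 p
  end.

Section Divisors.
Variables (k : graph_kind) (G : graph k).
Implicit Types (D E : divisor G) (v w p : points G).

Definition pdiv_mul (n : int) p : divisor G := << n *g p >>.

Definition effective D : Prop := forall p, 0 <= coeff p D.

Definition lin_equiv D E : Prop := principal (D - E).

Definition equiv_effective D : Prop := exists2 E, effective E & lin_equiv D E.

Definition rank_ge D (n : nat) : Prop :=
  forall E, effective E -> deg E = n%:Z -> equiv_effective (D - E).

Definition is_rank D (r : int) : Prop :=
  (~ equiv_effective D /\ r = -1) \/
  (equiv_effective D /\ exists n : nat,
     [/\ r = n%:Z, rank_ge D n & forall m, rank_ge D m -> (m <= n)%N]).

Definition rank D : int := xget (-1) [set r | is_rank D r].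

(* Since [-1 <= rank], the absolute value is the natural number [rank + 1]. *)
Definition transmission_function D v w (a b : int) : nat :=
  absz (rank (D + pdiv_mul (a - 1) v - pdiv_mul b w) + 1).

Definition Delta D v w : int :=
  rank D - rank (D - pdiv_mul 1 v) - rank (D - pdiv_mul 1 w)
  + rank (D - pdiv_mul 1 v - pdiv_mul 1 w).

Definition submodular D v w : Prop :=
  forall a b : int, 0 <= Delta (D + pdiv_mul a v - pdiv_mul b w) v w.

(* [z] is the number of elements of the set [A], which is finite. *)
Definition is_card (A : set int) (z : int) : Prop :=
  finite_set A /\ z = #|` fset_set A|%:Z.

Definition is_transmission_permutation D v w (tau : int -> int) : Prop :=
  bijective tau /\ forall a b : int,
    is_card [set n : int | b <= n /\ tau n <= a]
      (rank (D + pdiv_mul a v - pdiv_mul b w) + 1) /\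
    is_card [set n : int | n < b /\ a < tau n]
      (rank (canonical G - D - pdiv_mul a v + pdiv_mul b w) + 1).

End Divisors.

Definition push (k : graph_kind) (G H : graph k) (i : points G -> points H)
    (D : divisor G) : divisor H :=
  \sum_(p <- dom D) pdiv_mul (coeff p D) (i p).

Lemma star_ex (s1 s2 : int -> int -> nat) (a b : int) :
  exists n : nat, `[< exists l : int, n = (s1 a l + s2 l b)%N >].
Proof. by exists (s1 a 0 + s2 0 b)%N; apply/asboolP; exists 0. Qed.

Definition star (s1 s2 : int -> int -> nat) (a b : int) : nat :=
  ex_minn (star_ex s1 s2 a b).

Definition perm_set (tau : int -> int) (a b : int) : set int :=
  [set n : int | b <= n /\ tau n < a].

(* Only meaningful when [perm_set tau a b] is finite. *)
Definition s_perm (tau : int -> int) (a b : int) : nat :=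
  #|` fset_set (perm_set tau a b)|.

Definition almost_sign_preserving (tau : int -> int) : Prop :=
  exists tauV : int -> int, [/\ cancel tau tauV, cancel tauV tau,
    finite_set (perm_set tau 0 0) & finite_set (perm_set tauV 0 0)].

Definition is_demazure_product (alpha beta gamma : int -> int) : Prop :=
  [/\ almost_sign_preserving alpha, almost_sign_preserving beta,
      almost_sign_preserving gamma &
      s_perm gamma = star (s_perm alpha) (s_perm beta)].

(* Main.v *)
Require Import Defs.
From mathcomp Require Import all_boot all_order all_algebra.
From mathcomp Require Import finmap boolp classical_sets cardinality reals.
From mathcomp Require Import freeg Rstruct zify ring lra.

Set Implicit Arguments.
Unset Strict Implicit.
Unset Printing Implicit Defensive.

Import Order.TTheory GRing.Theory Num.Theory.
Import Defs.

Local Open Scope ring_scope.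

(** Write p for the gluing point.  A rational function on the gluing is a pair
    of rational functions that agree at p, so D1 + D2 is equivalent to an
    effective divisor exactly when D1 - l p and D2 + l p both are, for some
    integer l ([wedge_equiv_effective]).  Let E1 range over the effective divisors
    of degree e1.  The worst of them leaves D1 - E1 able to spare precisely l chips
    at p, where l is the largest integer with r(D1 - l p) >= e1; therefore
    r(D1 + D2) >= n holds exactly when for all e1 + e2 = n a single l satisfies
    r(D1 - l p) >= e1 and r(D2 + l p) >= e2 ([wedge_rank_ge]).  As the two ranks
    are monotone in l, in opposite directions, these conditions taken for all n
    say that r(D1 + D2) + 1 is the minimum of the sums
    (r(D1 - l p) + 1) + (r(D2 + (l - 1) p) + 1), which is the first formula
    ([wedge_rank_le], [wedge_rank_attained]).

    The existence of the permutations rests on the Riemann-Roch theorem.  It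
    makes s(a, b) = r(D + a v - b w) + 1 equal to 0 for a - b very negative and to
    a - b + C for a - b very positive, so a first difference of s in one variable
    takes both values 0 and 1 as the other variable runs.  Submodularity makes it
    monotone, and the mixed second difference of s is then a permutation matrix
    ([submodular_permutation]).  The formula for permutations is the formula for
    functions, because the permutation recovers s ([s_perm_transmission]).

    Riemann-Roch follows from one property ([riemann_roch]): a divisor D that is
    not equivalent to an effective one has a companion mu of degree g - 1, not
    equivalent to an effective divisor, such that K - mu - D is.  To find mu, make
    D reduced at a vertex q, burn the graph from q by Dhar's algorithm, and let
    mu(v) be the number of edges from v to vertices that burn later, minus one
    ([burning_order], [order_divisor_noneffective]).

    Finite and metric graphs share this argument.  Among convex piecewise linear
    functions with integer slopes on an edge of length l, with values x and y at
    its ends, one attains the largest outgoing slopes at both ends at once, namely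
    the integer parts of (y - x) / l and (x - y) / l ([convex_chord]).  A divisor D
    supported on the vertices is thus equivalent to an effective one exactly when
    D + L F >= 0 for some real function F on the vertices, with the superadditive
    operator L of [floor_laplacian].  Finite graphs are the case of unit lengths,
    where a real solution can be rounded down ([floor_laplacian_round]).  The
    reduced divisor comes from the pointwise largest F with F(q) = 0 that makes
    D + L F nonnegative away from q ([max_rooted_solution]).  On a metric graph the
    chips it leaves inside the edges become vertices after a subdivision of the
    model ([refine_points]). *)

(** * Pushing divisors forward *)

Section Push.
Variables (k : graph_kind) (G H : graph k) (i : points G -> points H).
Implicit Types D E : divisor G.

(** A sum over any list that contains the support, so that two divisors can
    be pushed forward along the same list. *)
Lemma push_sumE (s : seq (points G)) D : uniq s -> {subset dom D <= s} ->
  push i D = \sum_(p <- s) pdiv_mul (coeff p D) (i p).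
Proof.
move=> us sub; rewrite /push [RHS](bigID (mem (dom D))) /= [X in _ + X]big1 ?addr0.
  rewrite -[RHS]big_filter; apply: perm_big; apply: uniq_perm.
  - exact: uniq_dom.
  - exact: filter_uniq.
  - by move=> p; rewrite mem_filter; case: (boolP (p \in dom D)) => // /sub ->.
by move=> p np; rewrite coeff_outdom // /pdiv_mul freegU0.
Qed.

Lemma pushB : {morph push i : D E / D - E}.
Proof.
move=> D E; pose s := undup (dom D ++ dom E).
have us : uniq s by exact: undup_uniq.
rewrite !(@push_sumE s) //.
- rewrite -sumrB; apply: eq_bigr => p _.
  by rewrite /pdiv_mul freegUB coeffB.
- by move=> p hp; rewrite mem_undup mem_cat hp orbT.
- by move=> p hp; rewrite mem_undup mem_cat hp.
- by move=> p /domB hp; rewrite mem_undup.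
Qed.

Lemma push0 : push i 0 = 0.
Proof. by rewrite -[X in push i X](subrr 0) pushB subrr. Qed.

Lemma pushN : {morph push i : D / - D}.
Proof. by move=> D; rewrite -sub0r pushB push0 sub0r. Qed.

Lemma pushD : {morph push i : D E / D + E}.
Proof. by move=> D E; rewrite -{1}[E]opprK pushB pushN opprK. Qed.

Lemma pushU n p : push i (pdiv_mul n p) = pdiv_mul n (i p).
Proof.
rewrite (@push_sumE [:: p]) // => [|q].
  by rewrite big_seq1 /pdiv_mul coeffU eqxx mulr1.
rewrite inE mem_dom coeffU eq_sym; case: (eqVneq p q) => // _.
by rewrite mulr0 eqxx.
Qed.

Lemma push_sum (I : Type) (r : seq I) (P : pred I) (F : I -> divisor G) :
  push i (\sum_(j <- r | P j) F j) = \sum_(j <- r | P j) push i (F j).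
Proof. by apply: (big_morph _ pushD push0). Qed.

Lemma deg_push D : deg (push i D) = deg D.
Proof.
rewrite /push -[in RHS](freeg_sumE D) !raddf_sum /=.
by apply: eq_bigr => p _; rewrite !degU.
Qed.

Lemma coeff_push D q :
  coeff q (push i D) = \sum_(p <- dom D | i p == q) coeff p D.
Proof.
rewrite /push raddf_sum /= [RHS]big_mkcond; apply: eq_bigr => p _.
by rewrite coeffU; case: eqP; rewrite ?mulr1 ?mulr0.
Qed.

Lemma coeff_push_inj D p : injective i -> coeff (i p) (push i D) = coeff p D.
Proof.
move=> inj; rewrite coeff_push.
rewrite (eq_bigl (fun q => q == p)) => [|q]; last by rewrite inj_eq.
case: (boolP (p \in dom D)) => hp.
  rewrite (big_rem p) //= eqxx big1_seq ?addr0 // => q /andP[/eqP-> ].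
  by rewrite mem_rem_uniqF ?uniq_dom.
rewrite coeff_outdom // big1_seq // => q /andP[/eqP-> ].
by rewrite (negPf hp).
Qed.

Lemma coeff_push_out D q : (forall p, i p != q) -> coeff q (push i D) = 0.
Proof. by move=> h; rewrite coeff_push big1 // => p /eqP e; case/eqP: (h p). Qed.

Lemma push_effective D : effective D -> effective (push i D).
Proof.
by move=> h q; rewrite coeff_push; apply: sumr_ge0 => p _; apply: h.
Qed.

End Push.

Lemma push_comp (k : graph_kind) (G1 G2 G3 : graph k)
    (i : points G1 -> points G2) (j : points G2 -> points G3) (D : divisor G1) :
  push j (push i D) = push (j \o i) D.
Proof.
by rewrite {2}/push push_sum; apply: eq_bigr => p _; rewrite pushU.
Qed.

Lemma push_id (k : graph_kind) (G : graph k) (i : points G -> points G)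
  (D : divisor G) : i =1 id -> push i D = D.
Proof.
move=> h; rewrite -[RHS]freeg_sumE; apply: eq_bigr => p _.
by rewrite h.
Qed.

(** * Rank and the Riemann-Roch formula *)

Definition principal_group (k : graph_kind) (G : graph k) : Prop :=
  [/\ principal (0 : divisor G),
      forall D E : divisor G, principal D -> principal E -> principal (D - E) &
      forall D : divisor G, principal D -> deg D = 0].

Section Rank.
Variables (k : graph_kind) (G : graph k).
Hypothesis pg : principal_group G.
Implicit Types D E : divisor G.

Lemma principal0 : principal (0 : divisor G). Proof. by case: pg. Qed.

Lemma principalB D E : principal D -> principal E -> principal (D - E).
Proof. by case: pg => _ h _; apply: h. Qed.

Lemma principalN D : principal D -> principal (- D).
Proof. by move=> h; rewrite -sub0r; apply: principalB => //; apply: principal0. Qed.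

Lemma principalD D E : principal D -> principal E -> principal (D + E).
Proof.
by move=> hD hE; rewrite -[E]opprK; apply: principalB => //; apply: principalN.
Qed.

Lemma principal_deg D : principal D -> deg D = 0.
Proof. by case: pg => _ _ h; apply: h. Qed.

Lemma effectiveD D E : effective D -> effective E -> effective (D + E).
Proof. by move=> hD hE p; rewrite coeffD addr_ge0. Qed.

Lemma effective0 : effective (0 : divisor G).
Proof. by move=> p; rewrite coeff0. Qed.

Lemma effectiveU (n : int) (p : points G) : 0 <= n -> effective (pdiv_mul n p).
Proof. by move=> n0 q; rewrite coeffU mulr_ge0. Qed.

Lemma effective_deg D : effective D -> 0 <= deg D.
Proof.
move=> h; rewrite -(freeg_sumE D) raddf_sum /=; apply: sumr_ge0 => p _.
by rewrite degU.
Qed.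

Lemma effective_deg0 D : effective D -> deg D = 0 -> D = 0.
Proof. by move=> h; apply: fgpos_eq0P; apply/fgposP. Qed.

Lemma equiv_effective_trans D E :
  principal (D - E) -> equiv_effective E -> equiv_effective D.
Proof.
move=> DE [F effF EF]; exists F => //.
rewrite /lin_equiv (_ : D - F = (D - E) + (E - F)); last by rewrite addrA subrK.
exact: principalD.
Qed.

Lemma equiv_effectiveD D E :
  effective E -> equiv_effective D -> equiv_effective (D + E).
Proof.
move=> effE [F effF DF]; exists (F + E); first exact: effectiveD.
by rewrite /lin_equiv opprD addrACA subrr addr0.
Qed.

Lemma effective_equiv D : effective D -> equiv_effective D.
Proof. by move=> h; exists D => //; rewrite /lin_equiv subrr; apply: principal0. Qed.

Lemma equiv_effective_deg D : equiv_effective D -> 0 <= deg D.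
Proof.
case=> E effE /principal_deg; rewrite raddfB /= => /subr0_eq ->.
exact: effective_deg.
Qed.

Lemma rank_ge0 D : rank_ge D 0 <-> equiv_effective D.
Proof.
split=> [h|h E effE /(effective_deg0 effE) ->]; last by rewrite subr0.
by have := h 0 effective0; rewrite raddf0 subr0; apply.
Qed.

Section Pointed.
Variable q : points G.

Lemma rank_ge_le D (m n : nat) : (m <= n)%N -> rank_ge D n -> rank_ge D m.
Proof.
move=> le h E effE dE.
have eff2 : effective (pdiv_mul (n - m)%N%:Z q) by exact: effectiveU.
have := h (E + pdiv_mul (n - m)%N%:Z q) (effectiveD effE eff2).
rewrite raddfD /= degU dE -PoszD subnKC // => /(_ erefl) h2.
have := equiv_effectiveD eff2 h2.
by rewrite opprD addrA subrK.
Qed.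

Lemma rank_ge_deg D (n : nat) : rank_ge D n -> n%:Z <= deg D.
Proof.
move=> h; have := h (pdiv_mul n%:Z q) (effectiveU _ _) (degU _ _).
by move=> /(_ isT)/equiv_effective_deg; rewrite raddfB /= degU subr_ge0.
Qed.

Lemma is_rank_exists D : exists r, is_rank D r.
Proof.
have [e|ne] := pselect (equiv_effective D); last by exists (-1); left.
have ex : exists n, `[< rank_ge D n >] by exists 0%N; apply/asboolP/rank_ge0.
have ub n : `[< rank_ge D n >] -> (n <= absz (deg D))%N.
  by move=> /asboolP/rank_ge_deg; lia.
case: (ex_maxnP ex ub) => n /asboolP hn mx.
exists n%:Z; right; split=> //; exists n; split=> // m hm.
exact/mx/asboolP.
Qed.

Lemma rank_spec D :
  -1 <= rank D /\ forall n : nat, rank_ge D n <-> n%:Z <= rank D.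
Proof.
have : is_rank D (rank D) by exact: (xgetPex (-1) (is_rank_exists D)).
case=> [[ne ->]|[e [n [-> hn mx]]]]; split=> //.
  move=> n; split=> [/(rank_ge_le (leq0n n))/rank_ge0 //|]; lia.
move=> m; split=> [/mx //|le]; apply: rank_ge_le hn; lia.
Qed.

Lemma rank_geN1 D : -1 <= rank D. Proof. by case: (rank_spec D). Qed.

Lemma rank_geP D (n : nat) : rank_ge D n <-> n%:Z <= rank D.
Proof. by case: (rank_spec D) => _; apply. Qed.

Lemma rank_equiv_effective D : equiv_effective D <-> 0 <= rank D.
Proof. by rewrite -rank_ge0; apply: rank_geP. Qed.

Lemma rank_neg D : deg D < 0 -> rank D = -1.
Proof.
move=> dD; have := rank_geN1 D.
suff : ~ (0 <= rank D) by lia.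
by move/rank_equiv_effective/equiv_effective_deg; lia.
Qed.

Lemma rank_leD D E : effective E -> rank D <= rank (D + E).
Proof.
move=> effE; have := rank_geN1 D; case e : (rank D) => [n|n]; last first.
  by have := rank_geN1 (D + E); lia.
move=> _; apply/rank_geP => F effF dF.
have := (rank_geP D n).2; rewrite e => /(_ (lexx _) F effF dF) h.
by rewrite addrAC; apply: equiv_effectiveD.
Qed.

Lemma rank_subU_le D p : rank (D - pdiv_mul 1 p) <= rank D.
Proof. by rewrite -[X in _ <= rank X](subrK (pdiv_mul 1 p)); apply/rank_leD/effectiveU. Qed.

Lemma rank_subU_ge D p : rank D - 1 <= rank (D - pdiv_mul 1 p).
Proof.
have := rank_geN1 D; have := rank_geN1 (D - pdiv_mul 1 p).
case e : (rank D) => [[|n]|n]; [lia| |lia] => _ _.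
rewrite (_ : n.+1%:Z - 1 = n%:Z); last by lia.
apply/rank_geP => E effE dE.
have := (rank_geP D n.+1).2; rewrite e => /(_ (lexx _) (pdiv_mul 1 p + E)).
rewrite opprD addrA; apply; first by apply: effectiveD => //; apply: effectiveU.
by rewrite raddfD /= degU dE; lia.
Qed.

(** With nu = K - mu this is the criterion of Baker and Norine: up to linear
    equivalence, D lies below the divisor nu of degree g - 1, whose residual mu is
    not effective. *)
Definition residual_witness (g1 : int) D : Prop := exists mu : divisor G,
  [/\ deg mu = g1, ~ equiv_effective mu & equiv_effective (canonical G - mu - D)].

Definition riemann_roch_witness : Prop :=
  exists2 g1 : int, deg (canonical G) = 2 * g1 &
  forall D, ~ equiv_effective D -> residual_witness g1 D.

(** An effective E of degree r(D) + 1 that D cannot pay makes D - E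
    noneffective.  Its companion mu lies above K - D - E' for an effective E' of
    degree g - deg D + r(D), so K - D cannot pay E'.  This bounds r(K - D) from
    above; the same bound for K - D in place of D is the opposite inequality. *)
Lemma riemann_roch : riemann_roch_witness ->
  exists g1 : int, forall D, rank D - rank (canonical G - D) = deg D - g1.
Proof.
case=> g1 dK H; exists g1.
have ineq D : rank (canonical G - D) <= rank D + g1 - deg D.
  have [n en] : exists n : nat, rank D + 1 = n%:Z.
    by exists (absz (rank D + 1)); have := rank_geN1 D; lia.
  have /existsNP[E] : ~ rank_ge D n by move/rank_geP; lia.
  move=> /not_implyP[effE /not_implyP[dE]].
  case/H => mu [dmu nmu [E' effE' eqE']].
  have dE' : deg E' = g1 - deg D + n%:Z.
    have := principal_deg eqE'; rewrite !raddfB /=; lia.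
  have dE'0 := effective_deg effE'.
  case: (lerP (rank (canonical G - D)) (rank D + g1 - deg D)) => // lt.
  have [m em] : exists m : nat, deg E' = m%:Z by exists (absz (deg E')); lia.
  have /rank_geP : m%:Z <= rank (canonical G - D) by lia.
  move=> /(_ E' effE' em) h; case: nmu.
  apply: equiv_effective_trans (equiv_effectiveD effE h).
  have -> : mu - (canonical G - D - E' + E) = - (canonical G - mu - (D - E) - E').
    by apply/eqP/freeg_eqP => z; rewrite !(coeffD, coeffN); ring.
  exact: principalN.
move=> D; have := ineq D; have := ineq (canonical G - D).
by rewrite subKr raddfB /=; lia.
Qed.

End Pointed.
End Rank.
(** * Chip firing with rounded slopes *)

Section Darts.
Variable M : multigraph.

(** An edge with a direction; [true] stands for the direction from head to tail.
    A loop gives two darts at its vertex. *)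
Definition dart : finType := (edge M * bool)%type.
Definition src (h : dart) : vertex M := if h.2 then head h.1 else tail h.1.
Definition dst (h : dart) : vertex M := if h.2 then tail h.1 else head h.1.

Lemma sum_darts (A : nmodType) (f : dart -> A) (v : vertex M) :
  \sum_(h | src h == v) f h = \sum_(e | tail e == v) f (e, false)
                            + \sum_(e | head e == v) f (e, true).
Proof.
rewrite big_mkcond /= (eq_bigr (fun h : dart =>
  (fun e b => if src (e, b) == v then f (e, b) else 0) h.1 h.2)); last by case.
rewrite -(pair_bigA _ (fun e b => if src (e, b) == v then f (e, b) else 0)) /=.
rewrite exchange_big big_bool addrC /=.
by congr (_ + _); rewrite [RHS]big_mkcond.
Qed.

Lemma adjacentP (x y : vertex M) :
  reflect (exists2 h, src h = x & dst h = y) (adjacent x y).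
Proof.
apply: (iffP existsP) => [[e /orP[|] /andP[/eqP <- /eqP <-]]|[[e b] <- <-]].
- by exists (e, false).
- by exists (e, true).
- by exists e; case: b; rewrite /src /dst /= !eqxx ?orbT.
Qed.

Lemma val_darts (v : vertex M) : val v = (\sum_(h | src h == v) 1)%N.
Proof.
by rewrite /val -!sum1_card (@sum_darts nat (fun=> 1%N)).
Qed.

Lemma sum_vertices_darts (A : nmodType) (f : dart -> A) :
  \sum_v \sum_(h | src h == v) f h = \sum_e (f (e, true) + f (e, false)).
Proof.
transitivity (\sum_h f h); first by rewrite (partition_big src xpredT).
rewrite (eq_bigr (fun h : dart => (fun e b => f (e, b)) h.1 h.2)); last by case.
rewrite -(pair_bigA _ (fun e b => f (e, b))) /=; apply: eq_bigr => e _.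
by rewrite big_bool.
Qed.

End Darts.

Lemma le_floorD (R : realType) (x y : R) :
  Num.floor x + Num.floor y <= Num.floor (x + y).
Proof. by rewrite floor_ge_int rmorphD /= lerD // floor_le. Qed.

Lemma small_common (R : realType) (I : finType) (P : I -> R -> Prop) :
  (forall i, exists2 d : R, 0 < d & forall x, 0 < x <= d -> P i x) ->
  exists2 x, 0 < x & forall i, P i x.
Proof.
move=> H; suff [d d0 hd] : exists2 d : R, 0 < d &
    forall i, i \in enum I -> forall x, 0 < x <= d -> P i x.
  by exists d => // i; apply: (hd i); rewrite ?mem_enum // d0 lexx.
elim: (enum I) => [|i s [d d0 hd]]; first by exists 1.
have [d' d'0 hd'] := H i; exists (Num.min d d'); first by rewrite lt_min d0.
move=> j; rewrite inE => /orP[/eqP-> | js] x; rewrite le_min => /and3P[x0 xd xd'].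
  by apply: hd'; rewrite x0.
by apply: hd; rewrite ?x0.
Qed.

Section FloorLaplacian.
Variables (M : multigraph) (R : realType) (l : edge M -> R).
Hypothesis l_gt0 : forall e, 0 < l e.
Hypothesis connM : connected_graph M.
Implicit Types (F : vertex M -> R) (D : vertex M -> int).

Definition floor_slope F (h : dart M) : int :=
  Num.floor ((F (dst h) - F (src h)) / l h.1).

(** The largest numbers of chips that the vertices can gain from a function
    with integer slopes and vertex values [F]; on each edge the surplus chip, if
    the mean slope is not an integer, is left inside the edge. *)
Definition floor_laplacian F (v : vertex M) : int :=
  \sum_(h | src h == v) floor_slope F h.

Lemma floor_laplacianD F1 F2 v : floor_laplacian F1 v + floor_laplacian F2 v
  <= floor_laplacian (fun x => F1 x + F2 x) v.
Proof.
rewrite -big_split; apply: ler_sum => h _; apply: le_trans (le_floorD _ _) _.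
by rewrite -mulrDl /floor_slope; apply: le_floor; rewrite le_eqVlt; apply/orP; left;
   apply/eqP; congr (_ / _); ring.
Qed.

Lemma floor_laplacianMn F (n : nat) v :
  n%:Z * floor_laplacian F v <= floor_laplacian (fun x => n%:R * F x) v.
Proof.
elim: n => [|n IH].
  rewrite mul0r; apply: sumr_ge0 => h _.
  by rewrite /floor_slope !mul0r subrr mul0r floor0.
have := floor_laplacianD F (fun x => n%:R * F x) v.
rewrite (_ : floor_laplacian (fun x => F x + n%:R * F x) v
           = floor_laplacian (fun x => n.+1%:R * F x) v).
  by lia.
apply: eq_bigr => h _; congr (Num.floor (_ / _)).
by rewrite -natr1; ring.
Qed.

Definition length_bound : R := \sum_e l e.

Lemma length_bound_ge e : l e <= length_bound.
Proof.
rewrite /length_bound (bigD1 e) //= lerDl.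
by apply: sumr_ge0 => e' _; apply: ltW.
Qed.

(** Raising [v] by the total length of the graph sends a chip to all its
    neighbours. *)
Lemma pay_neighbour (u v : vertex M) : adjacent u v -> u != v ->
  exists F, (forall w, w != v -> 0 <= floor_laplacian F w)
    /\ 1 <= floor_laplacian F u.
Proof.
move=> /adjacentP[h hu hv] uv.
pose F x := if x == v then length_bound else 0.
have Lb0 : 0 <= length_bound by apply: sumr_ge0 => e _; apply: ltW.
have pos w g : w != v -> src g == w -> 0 <= floor_slope F g.
  move=> wv /eqP gw; rewrite /floor_slope floor_ge0 divr_ge0 ?(ltW (l_gt0 _)) //.
  by rewrite /F gw (negPf wv) subr0; case: ifP.
exists F; split=> [w wv|]; first by apply: sumr_ge0 => g; apply: pos.
rewrite /floor_laplacian (bigD1 h) ?hu //= -[1]addr0 lerD //.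
  rewrite /floor_slope hu hv /F eqxx (negPf uv) subr0 floor_ge_int.
  by rewrite ler_pdivlMr // mul1r length_bound_ge.
by apply: sumr_ge0 => g /andP[gw _]; apply: pos gw.
Qed.

(** Along a path towards [q] the debt of each vertex is passed on to the next. *)
Lemma pay_root (q u : vertex M) : u != q ->
  exists F, (forall w, w != q -> 0 <= floor_laplacian F w)
    /\ 1 <= floor_laplacian F u.
Proof.
have /connectP[p] := connM u q; elim: p u => [|y p IH] u /=.
  by move=> _ ->; rewrite eqxx.
move=> /andP[uy pp] ql uq.
have [e|uny] := eqVneq u y; first by rewrite e; apply: IH => //; rewrite -e.
have [F1 [F1w F1u]] := pay_neighbour uy uny.
have [e|ynq] := eqVneq y q; first by exists F1; rewrite -e.
have [F2 [F2w F2y]] := IH y pp ql ynq.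
pose n := absz (floor_laplacian F1 y).
exists (fun x => F1 x + n%:R * F2 x).
have le w := le_trans (lerD (lexx _) (floor_laplacianMn F2 n w))
                      (floor_laplacianD F1 (fun x => n%:R * F2 x) w).
have n0 w : w != q -> 0 <= n%:Z * floor_laplacian F2 w.
  by move=> /F2w; apply: mulr_ge0.
split=> [w wq|].
  apply: le_trans (le w); have [->|wy] := eqVneq w y.
    have : n%:Z * 1 <= n%:Z * floor_laplacian F2 y by apply: ler_wpM2l.
    by rewrite mulr1 /n; lia.
  by apply: addr_ge0; [apply: F1w | apply: n0].
by apply: le_trans (le u); rewrite -[1]addr0; apply: lerD => //; apply: n0.
Qed.

Lemma pay_all (D : vertex M -> int) (q : vertex M) :
  exists F, forall w, w != q -> 0 <= D w + floor_laplacian F w.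
Proof.
suff H (s : seq (vertex M)) : exists F, forall w, w != q ->
    0 <= floor_laplacian F w /\ (w \in s -> 0 <= D w + floor_laplacian F w).
  have [F hF] := H (enum (vertex M)); exists F => w /hF[_]; apply.
  by rewrite mem_enum.
elim: s => [|u s [F hF]].
  by exists (fun=> 0) => w _; split=> //; apply: sumr_ge0 => h _;
    rewrite /floor_slope subrr mul0r floor0.
have [e|uq] := eqVneq u q.
  exists F => w wq; have [h1 h2] := hF w wq; split=> //.
  by rewrite inE e (negPf wq).
have [F2 [F2w F2u]] := pay_root uq.
pose n := absz (D u); exists (fun x => F x + n%:R * F2 x) => w wq.
have le := le_trans (lerD (lexx _) (floor_laplacianMn F2 n w))
                      (floor_laplacianD F (fun x => n%:R * F2 x) w).
have [h1 h2] := hF w wq; have h3 := F2w w wq.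
have n0 : 0 <= n%:Z * floor_laplacian F2 w by apply: mulr_ge0.
split; first by apply: le_trans le; apply: addr_ge0.
rewrite inE => /orP[/eqP e|ws]; last first.
  have := h2 ws; lia.
have : n%:Z * 1 <= n%:Z * floor_laplacian F2 u by apply: ler_wpM2l.
by move: le h1; rewrite e mulr1 /n; lia.
Qed.

Definition out_darts (A : {set vertex M}) (v : vertex M) : int :=
  \sum_(h : dart M | src h == v) (dst h \notin A)%:Z.

(** A set [A] that fires a little loses one chip along each of its outgoing
    edges and none along the others. *)
Lemma floor_laplacian_fire F (A : {set vertex M}) (eps : R) v :
  0 <= eps -> (forall e, eps <= l e) ->
  floor_laplacian F v - (v \in A)%:Z * out_darts A v
    <= floor_laplacian (fun x => F x + eps * (x \in A)%:R) v.
Proof.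
move=> eps0 eps_l; rewrite /out_darts mulr_sumr -sumrB; apply: ler_sum => h /eqP hv.
have := eps_l h.1; have l0 := l_gt0 h.1; rewrite /floor_slope -hv => le.
case: (src h \in A); case: (dst h \in A); rewrite /= ?mul1r ?mul0r ?subr0.
- apply: le_floor; rewrite ler_pM2r ?invr_gt0 //; lra.
- rewrite floor_ge_int ler_pdivlMr // rmorphB /=.
  have := floor_le ((F (dst h) - F (src h)) / l h.1).
  rewrite ler_pdivlMr //; lra.
- apply: le_floor; rewrite ler_pM2r ?invr_gt0 //; lra.
- apply: le_floor; rewrite ler_pM2r ?invr_gt0 //; lra.
Qed.

Definition rooted_solution D (q : vertex M) F : Prop :=
  F q = 0 /\ forall v, v != q -> 0 <= D v + floor_laplacian F v.

Lemma rooted_solution_exists D q : exists F, rooted_solution D q F.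
Proof.
have [F hF] := pay_all D q; exists (fun x => F x - F q); split; first exact: subrr.
move=> v /hF; congr (0 <= _ + _); apply: eq_bigr => h _.
by congr (Num.floor (_ / _)); ring.
Qed.

(** At a vertex where [F] is close to its maximum the slopes are bounded above
    and their sum is bounded below, so none of them is very negative; the bound is
    uniform in [F]. *)
Lemma near_max_step D (h : dart M) (B : R) : 0 <= B ->
  exists2 B', 0 <= B' & forall F m, 0 <= D (src h) + floor_laplacian F (src h) ->
    (forall w, F w <= m) -> m - B <= F (src h) -> m - B' <= F (dst h).
Proof.
move=> B0; pose u := src h.
pose C : int := `|D u| + \sum_(g | (src g == u) && (g != h)) Num.floor (B / l g.1).
have C0 : 0 <= C.
  apply: addr_ge0 => //; apply: sumr_ge0 => g _.
  by rewrite floor_ge0 divr_ge0 // ltW.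
exists (B + C%:~R * l h.1).
  by apply: addr_ge0 => //; apply: mulr_ge0; rewrite ?ler0z // ltW.
move=> F m; rewrite -/u /floor_laplacian (bigD1 h) //= => hD Fm mB.
have {hD} : - C <= floor_slope F h.
  have : \sum_(g | (src g == u) && (g != h)) floor_slope F g
      <= \sum_(g | (src g == u) && (g != h)) Num.floor (B / l g.1).
    apply: ler_sum => g /andP[/eqP gu _]; apply: le_floor.
    rewrite ler_pM2r ?invr_gt0 // gu lerBlDl.
    by apply: le_trans (Fm _) _; rewrite -lerBlDr.
  move: hD; rewrite /C; set X := floor_slope F h; set Y := \sum_(_ | _) _.
  set Z := \sum_(_ | _) _; clearbody X Y Z; lia.
rewrite /floor_slope floor_ge_int -/u ler_pdivlMr // => hF.
by move: hF mB; rewrite rmorphN mulNr; lra.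
Qed.

(** Walk from a vertex where [F] is maximal to [q], where [F] vanishes: each
    step loses a bounded amount. *)
Lemma rooted_solution_bounded D q :
  exists B, forall F, rooted_solution D q F -> forall v, F v <= B.
Proof.
have path_bound (u : vertex M) (B : R) : 0 <= B -> exists2 B', 0 <= B' &
    forall F m, rooted_solution D q F -> (forall w, F w <= m) ->
    m - B <= F u -> m <= B'.
  have /connectP[p] := connM u q; elim: p u B => [|y p IH] u B /=.
    by move=> _ <- B0; exists B => // F m [-> _] _; rewrite subr_le0.
  move=> /andP[/adjacentP[h hu hy] pp] ql B0.
  have [e|uq] := eqVneq u q.
    by exists B => // F m [Fq _] _; rewrite e Fq subr_le0.
  have [B1 B10 hB1] := near_max_step D h B0.
  have [B2 B20 hB2] := IH y B1 pp ql B10.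
  exists B2 => // F m sF Fm mB; apply: (hB2 F m sF Fm).
  rewrite -hy; apply: hB1 => //; rewrite hu //.
  by case: sF => _; apply.
have /choice[b hb] : forall u, exists B : R, 0 <= B /\
    forall F m, rooted_solution D q F -> (forall w, F w <= m) -> m <= F u -> m <= B.
  move=> u; have [B B0 hB] := path_bound u 0 (lexx _).
  by exists B; split=> // F m sF Fm mu; apply: (hB F) => //; rewrite subr0.
exists (\sum_u b u) => F sF v.
pose a := [arg max_(i > q) F i]%O.
have maxa w : F w <= F a by rewrite /a; case: arg_maxP => // i _ hi; apply: hi.
apply: le_trans (maxa v) _.
apply: le_trans ((hb a).2 F _ sF maxa (lexx _)) _.
by rewrite (bigD1 a) //= lerDl; apply: sumr_ge0 => w _; case: (hb w).
Qed.

Lemma floor_right (x y : R) : 0 < y ->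
  exists2 d : R, 0 < d & forall z, 0 < z <= d ->
    Num.floor ((x + z) / y) <= Num.floor (x / y).
Proof.
move=> y0; set n := Num.floor (x / y).
have xn : x < (n + 1)%:~R * y by rewrite -ltr_pdivrMr // floorD1_gt.
exists (((n + 1)%:~R * y - x) / 2); first by rewrite divr_gt0 // subr_gt0.
move=> z /andP[z0 zd]; rewrite -ltzD1 floor_lt_int ltr_pdivrMr //; lra.
Qed.

(** The floor function is upper semicontinuous, so a defect of the pointwise
    supremum at a vertex would already show on a solution close to it there. *)
Lemma max_rooted_solution D q : exists2 F, rooted_solution D q F &
  forall F', rooted_solution D q F' -> forall v, F' v <= F v.
Proof.
pose S v : set R := [set x | exists2 F, rooted_solution D q F & F v = x]%classic.
have [B hB] := rooted_solution_bounded D q.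
have [F0 sF0] := rooted_solution_exists D q.
have supS v : has_sup (S v).
  split; first by exists (F0 v), F0.
  by exists B => x [F sF <-]; apply: hB.
have ub F v : rooted_solution D q F -> F v <= sup (S v).
  by move=> sF; apply: sup_upper_bound => //; exists F.
exists (fun v => sup (S v)); last by move=> F sF v; apply: ub.
split.
  apply/eqP; rewrite eq_le; apply/andP; split.
    by apply: ge_sup; [exists (F0 q), F0 | move=> x [F [-> _] <-]].
  by case: (sF0) => {1}<- _; apply: ub.
move=> v vq; set Fm := fun v => sup (S v).
have [d d0 hd] : exists2 d, 0 < d & forall h : dart M,
    Num.floor ((Fm (dst h) - Fm (src h) + d) / l h.1) <= floor_slope Fm h.
  by apply: small_common => h; apply: floor_right.
have [x [F sF <-] lt] := sup_adherent d0 (supS v).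
apply: le_trans (sF.2 v vq) _; rewrite lerD2l; apply: ler_sum => h /eqP hv.
apply: le_trans (hd h); apply: le_floor; rewrite ler_pM2r ?invr_gt0 //.
have := ub F (dst h) sF; rewrite hv -/(Fm (dst h)); move: lt; rewrite -/(Fm v); lra.
Qed.

End FloorLaplacian.

(** * Burning orders *)

Section Burning.
Variables (M : multigraph).

(** Dhar's burning algorithm: the fire starts at [q], and the hypothesis applied
    to the set of unburnt vertices provides the next vertex to burn. *)
Lemma burning_order (D : vertex M -> int) (q : vertex M) :
  (forall A : {set vertex M}, q \notin A -> A != finset.set0 -> exists2 v, v \in A &
     D v < out_darts A v) ->
  exists2 ord : vertex M -> nat, injective ord &
    (forall v, v != q ->
      D v < \sum_(h : dart M | src h == v) (ord (dst h) < ord v)%N%:Z).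
Proof.
move=> burn.
pose good s v := D v < \sum_(h : dart M | src h == v)
  (index (dst h) s < index v s)%N%:Z.
have step n : (n < #|vertex M|)%N -> exists s : seq (vertex M),
    [/\ size s = n.+1, uniq s, q \in s &
     forall v, v \in s -> v != q -> good s v].
  elim: n => [_|n IH lt].
    exists [:: q]; split=> //=; first by rewrite inE.
    by move=> v; rewrite inE => ->.
  have [s [ss us q_in hs]] := IH (ltnW lt).
  pose A : {set vertex M} := [set x | x \notin s].
  have qA : q \notin A by rewrite inE q_in.
  have A0 : A != finset.set0.
    apply/negP => /eqP/finset.setP e; move: lt; rewrite -ss ltnNge cardE.
    rewrite uniq_leq_size ?enum_uniq // => x _.
    by have := e x; rewrite !inE => /negbFE.
  have [v vA hv] := burn A qA A0; have vs : v \notin s by move: vA; rewrite inE.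
  have idx x : x \in s -> index x (rcons s v) = index x s.
    by move=> xs; rewrite -cats1 index_cat xs.
  have idv : index v (rcons s v) = size s.
    by rewrite -cats1 index_cat (negPf vs) /= eqxx addn0.
  exists (rcons s v); split.
  - by rewrite size_rcons ss.
  - by rewrite rcons_uniq vs.
  - by rewrite mem_rcons inE q_in orbT.
  move=> x; rewrite mem_rcons inE => /orP[/eqP->|xs] xq; last first.
    apply: lt_le_trans (hs x xs xq) _; apply: ler_sum => h _; rewrite (idx x) //.
    case: (boolP (dst h \in s)) => [/idx-> // | ds].
    by rewrite ltnNge ltnW // (memNindex ds) index_mem.
  apply: lt_le_trans hv _; apply: ler_sum => h _; rewrite idv inE negbK.
  by case: (boolP (dst h \in s)) => // ds; rewrite idx // index_mem ds.
have V0 : (0 < #|vertex M|)%N by apply/card_gt0P; exists q.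
have [|s [ss us _ hs]] := step #|vertex M|.-1; first by rewrite prednK.
have all_s x : x \in s.
  have [_ ->] : (size s = size (enum (vertex M))) * (s =i enum (vertex M)).
    apply: uniq_min_size => // [y _|]; first by rewrite mem_enum.
    by rewrite ss prednK // cardE.
  by rewrite mem_enum.
exists (index^~ s) => [x y e|v vq]; last exact: hs.
by rewrite -(nth_index q (all_s x)) e nth_index.
Qed.

Variable ord : vertex M -> nat.
Hypothesis ord_inj : injective ord.
Hypothesis loopless : forall e : edge M, tail e != head e.

Definition later_darts (v : vertex M) : int :=
  \sum_(h : dart M | src h == v) (ord v < ord (dst h))%N%:Z.

Definition earlier_darts (v : vertex M) : int :=
  \sum_(h : dart M | src h == v) (ord (dst h) < ord v)%N%:Z.

Lemma later_earlier v : later_darts v + earlier_darts v = (val v)%:Z.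
Proof.
rewrite /later_darts /earlier_darts -big_split val_darts.
rewrite (big_morph Posz PoszD erefl) /=; apply: eq_bigr => h /eqP <-.
have : ord (src h) != ord (dst h).
  rewrite (inj_eq ord_inj) /src /dst; case: h => e [] /=; last exact: loopless.
  by rewrite eq_sym loopless.
by case: ltngtP.
Qed.

Lemma sum_val : (\sum_(v : vertex M) val v = 2 * #|edge M|)%N.
Proof.
under eq_bigr => v _ do rewrite val_darts.
by rewrite (sum_vertices_darts (fun=> 1%N)) sum_nat_const mulnC.
Qed.

Lemma sum_later : \sum_(v : vertex M) later_darts v = #|edge M|%:Z.
Proof.
rewrite -sum1_card (big_morph Posz PoszD erefl) /=.
transitivity (\sum_e ((ord (head e) < ord (tail e))%N%:Z
                     + (ord (tail e) < ord (head e))%N%:Z)).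
  rewrite -(sum_vertices_darts (fun h => (ord (src h) < ord (dst h))%N%:Z)).
  by apply: eq_bigr => v _; apply: eq_bigr => h /eqP <-.
apply: eq_bigr => e _; have : ord (tail e) != ord (head e).
  by rewrite (inj_eq ord_inj).
by case: ltngtP.
Qed.

(** At the last vertex among those where [F] is maximal, every later neighbour
    lies strictly below, so the chips leaving outnumber those present. *)
Lemma order_divisor_noneffective (R : realType) (l : edge M -> R)
    (F : vertex M -> R) (q : vertex M) : (forall e, 0 < l e) ->
  exists v, later_darts v - 1 + floor_laplacian l F v < 0.
Proof.
move=> l_gt0; pose a := [arg max_(i > q) F i]%O.
have maxa w : F w <= F a by rewrite /a; case: arg_maxP => // i _ hi; apply: hi.
pose v := [arg max_(i > a | F i == F a) ord i].
have [/eqP Fv vmax] : F v == F a /\ forall j, F j == F a -> (ord j <= ord v)%N.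
  by rewrite /v; case: arg_maxnP => //= i hi h.
exists v; rewrite addrAC -big_split subr_lt0 /=.
apply: (@le_lt_trans _ _ 0) => //; apply: sumr_le0 => h /eqP hv.
have le : F (dst h) <= F v by rewrite Fv.
have : floor_slope l F h <= 0.
  rewrite floor_le0 hv (@le_lt_trans _ _ 0) ?ltr01 //.
  by rewrite pmulr_lle0 ?invr_gt0 // subr_le0.
case: ltnP => [lt|_]; last by rewrite add0r.
suff : floor_slope l F h < 0 by lia.
rewrite floor_lt0 hv pmulr_llt0 ?invr_gt0 // subr_lt0 lt_neqAle le andbT.
by apply: contraTneq lt => e; rewrite -leqNgt vmax // e Fv.
Qed.

End Burning.
(** * Finite graphs *)

Lemma sum_const_int (T : finType) (n : int) : \sum_(x : T) n = n * #|T|%:Z.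
Proof. by rewrite sumr_const -[in LHS]mulr_natr natz. Qed.

Lemma deg_sum (k : graph_kind) (G : graph k) (D : divisor G) (s : seq (points G)) :
  uniq s -> {subset dom D <= s} -> deg D = \sum_(p <- s) coeff p D.
Proof.
move=> us sub; rewrite -[in LHS](push_id (i := id) D) // (push_sumE _ us sub).
by rewrite raddf_sum; apply: eq_bigr => p _; apply: degU.
Qed.

Section FiniteGraph.
Variables (R : realType) (G : fgraph).
Implicit Types (f : vertex G -> int) (D : divisor (k := Finite) G).

Local Notation lap1 := (@floor_laplacian G R (fun=> 1)).

Definition vertex_divisor (c : vertex G -> int) : divisor (k := Finite) G :=
  \sum_(v : vertex G) << c v *g v >>.

Lemma coeff_vertex_divisor c v : coeff v (vertex_divisor c) = c v.
Proof.
rewrite raddf_sum /= (bigD1 v) //= coeffU eqxx mulr1 big1 ?addr0 // => w wv.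
by rewrite coeffU (negPf wv) mulr0.
Qed.

Lemma deg_finite D : deg D = \sum_v coeff v D.
Proof.
by rewrite (@deg_sum Finite G D (index_enum (vertex G))) ?index_enum_uniq // => v;
  rewrite mem_index_enum.
Qed.

Lemma laplacian_darts f v :
  laplacian f v = \sum_(h | src h == v) (f (dst h) - f (src h)).
Proof.
rewrite (sum_darts (fun h => f (dst h) - f (src h))) /=.
by congr (_ + _); apply: eq_bigr => e /eqP <-.
Qed.

Lemma laplacianB f1 f2 v :
  laplacian (fun x => f1 x - f2 x) v = laplacian f1 v - laplacian f2 v.
Proof.
rewrite !laplacian_darts -sumrB; apply: eq_bigr => h _; ring.
Qed.

Lemma laplacianN f v : laplacian (fun x => - f x) v = - laplacian f v.
Proof.
rewrite !laplacian_darts -sumrN; apply: eq_bigr => h _; ring.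
Qed.

Lemma laplacian_floor f v : laplacian f v = lap1 (fun x => (f x)%:~R) v.
Proof.
rewrite laplacian_darts; apply: eq_bigr => h _.
by rewrite /floor_slope divr1 -rmorphB /= intrKfloor.
Qed.

(** With unit lengths, rounding down a real solution gives an integral one. *)
Lemma floor_laplacian_round (F : vertex G -> R) v :
  lap1 F v <= laplacian (fun x => Num.floor (F x)) v.
Proof.
rewrite laplacian_darts; apply: ler_sum => h _; rewrite /floor_slope divr1.
have := le_floorD (F (dst h) - F (src h)) (F (src h)).
by rewrite subrK; lia.
Qed.

Lemma finite_principal_group : principal_group (k := Finite) G.
Proof.
split=> [|D E [f hf] [g hg]|D [f hf]].
- exists (fun=> 0) => v; rewrite laplacian_darts big1 ?coeff0 //.
- exists (fun x => f x - g x) => v.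
  by rewrite coeffB hf hg laplacianB.
rewrite deg_finite; under eq_bigr => v _ do rewrite hf laplacian_darts.
rewrite (sum_vertices_darts (fun h => f (dst h) - f (src h))) big1 // => e _.
by rewrite /src /dst /=; ring.
Qed.

Lemma finite_equiv_effectiveP D : equiv_effective D <->
  exists F : vertex G -> R, forall v : vertex G, 0 <= coeff v D + lap1 F v.
Proof.
split=> [[E effE [f hf]]|[F hF]].
  exists (fun x => (- f x)%:~R) => v; rewrite -laplacian_floor laplacianN -hf.
  by rewrite coeffB opprB addrC subrK.
pose f x := - Num.floor (F x).
exists (D - vertex_divisor (laplacian f)).
  move=> v; rewrite coeffB coeff_vertex_divisor laplacianN opprK.
  by apply: le_trans (hF v) _; rewrite lerD2l floor_laplacian_round.
exists f => v; rewrite opprB addrC subrK; exact: coeff_vertex_divisor.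
Qed.

(** The largest real rooted solution, rounded down, is the largest integral
    one.  A set that could still fire would give a larger one, so the fire reaches
    every vertex. *)
Lemma finite_riemann_roch_witness (q : vertex G) :
  riemann_roch_witness (k := Finite) G.
Proof.
have valK v : coeff v (fcanonical G) = (val v)%:Z - 2.
  exact: (coeff_vertex_divisor (fun v => (val v)%:Z - 2)).
exists (#|edge G|%:Z - #|vertex G|%:Z).
  rewrite deg_finite; under eq_bigr => v _ do rewrite valK.
  rewrite sumrB -(big_morph Posz PoszD erefl) /= sum_val sum_const_int PoszM; ring.
move=> D nD; have l1 (e : edge G) : 0 < (1 : R) by [].
have connG := @fgraph_connected G.
have [F [Fq hF] maxF] := max_rooted_solution l1 connG (fun v => coeff v D) q.
pose f x := Num.floor (F x); pose D1 (v : vertex G) : int := coeff v D + laplacian f v.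
have D1ge v : v != q -> 0 <= D1 v.
  move=> /hF h; apply: le_trans h _; rewrite lerD2l.
  exact: floor_laplacian_round.
have D1q : D1 q < 0.
  rewrite ltNge; apply/negP => D1q; apply: nD; apply/finite_equiv_effectiveP.
  exists (fun x => (f x)%:~R) => v; rewrite -laplacian_floor.
  by have [->|] := eqVneq v q; [apply: D1q | apply: D1ge].
have burn (A : {set vertex G}) : q \notin A -> A != finset.set0 ->
    exists2 v, v \in A & D1 v < out_darts A v.
  move=> qA A0; apply: contrapT => stuck.
  have hA v : v \in A -> out_darts A v <= D1 v.
    by move=> vA; rewrite leNgt; apply/negP => lt; apply: stuck; exists v.
  pose F' x : R := (f x)%:~R + 1 * (x \in A)%:R.
  have sF' : rooted_solution (fun=> 1) (fun v => coeff v D) q F'.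
    split=> [|v vq]; first by rewrite /F' /f Fq floor0 (negPf qA) mulr0 addr0.
    have := @floor_laplacian_fire G R (fun=> 1) l1 (fun x => (f x)%:~R) A 1 v
      ler01 (fun=> lexx 1).
    rewrite -laplacian_floor -/F'; have := D1ge v vq; have := hA v.
    rewrite /D1; case: (v \in A) => /=; last by lia.
    by move=> /(_ isT); lia.
  have /set0Pn[v vA] := A0.
  have := maxF F' sF' v; rewrite /F' vA mul1r -(intrD _ _ 1) -floor_ge_int -/(f v).
  by lia.
have [ord ord_inj ord_D] := burning_order burn.
have lless := @fgraph_loopless G.
exists (vertex_divisor (fun v => later_darts ord v - 1)); split.
- rewrite deg_finite; under eq_bigr => v _ do rewrite coeff_vertex_divisor.
  by rewrite sumrB sum_later // sum_const_int mul1r.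
- move/finite_equiv_effectiveP=> [F' hF'].
  have [v] := order_divisor_noneffective ord F' q l1.
  by have := hF' v; rewrite coeff_vertex_divisor; lia.
apply/finite_equiv_effectiveP; exists (fun x => (- f x)%:~R) => v.
rewrite -laplacian_floor laplacianN !coeffB /= valK coeff_vertex_divisor.
have := later_earlier ord_inj lless v.
suff : D1 v < earlier_darts ord v by rewrite /D1; lia.
have [->|] := eqVneq v q; last exact: ord_D.
by apply: lt_le_trans D1q _; apply: sumr_ge0.
Qed.

End FiniteGraph.
(** * Piecewise linear functions with integer slopes *)

Section PiecewiseLinear.
Variable R : realType.
Implicit Types (g : R -> R) (a b t x y : R) (m : int) (s : seq R).

Lemma seq_isolated s t : exists2 d : R, 0 < d &
  forall c, c \in s -> c != t -> d <= `|c - t|.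
Proof.
elim: s => [|c s [d d0 hd]]; first by exists 1.
have [->|ct] := eqVneq c t.
  by exists d => // c'; rewrite inE => /orP[/eqP->|]; [rewrite eqxx | apply: hd].
exists (Num.min d `|c - t|); first by rewrite lt_min d0 normr_gt0 subr_eq0.
move=> c'; rewrite inE ge_min => /orP[/eqP->|h1 h2]; first by rewrite lexx orbT.
by rewrite hd.
Qed.

Definition pl_on a b g : Prop := exists s : seq R, forall x y,
  a <= x -> x <= y -> y <= b -> (forall c, c \in s -> ~~ (x < c < y)) ->
  exists m : int, forall z, x <= z <= y -> g z = g x + m%:~R * (z - x).

Lemma pl_onB a b g1 g2 : pl_on a b g1 -> pl_on a b g2 ->
  pl_on a b (fun x => g1 x - g2 x).
Proof.
move=> [s1 h1] [s2 h2]; exists (s1 ++ s2) => x y ax xy yb hs.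
have [|m1 e1] := h1 x y ax xy yb; first by move=> c cs; apply: hs; rewrite mem_cat cs.
have [|m2 e2] := h2 x y ax xy yb.
  by move=> c cs; apply: hs; rewrite mem_cat cs orbT.
exists (m1 - m2) => z hz; rewrite (e1 z hz) (e2 z hz) rmorphB /=; ring.
Qed.

Lemma pl_on_cst a b (k : R) : pl_on a b (fun=> k).
Proof. by exists [::] => x y _ _ _ _; exists 0 => z _; rewrite mul0r addr0. Qed.

Lemma pl_on_opp a b g : pl_on a b g -> pl_on (- b) (- a) (fun x => g (- x)).
Proof.
move=> [s hs]; exists [seq - c | c <- s] => x y ax xy yb hc.
have [|||c cs|m hm] := hs (- y) (- x); [lra | lra | lra | |].
  have := hc (- c) (map_f _ cs); lra.
exists (- m) => z hz; rewrite (hm (- z)); last by lra.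
by rewrite (hm (- x)) ?rmorphN /=; last lra; ring.
Qed.

Lemma pl_on_sub a b a' b' g : a <= a' -> b' <= b -> pl_on a b g -> pl_on a' b' g.
Proof.
by move=> aa bb [s hs]; exists s => x y h1 h2 h3; apply: hs => //; lra.
Qed.

Lemma pl_on_shift a b g g' (k : R) :
  (forall t, a <= t <= b -> g' (t + k) = g t) -> pl_on a b g ->
  pl_on (a + k) (b + k) g'.
Proof.
move=> e [s hs]; exists [seq c + k | c <- s] => x y ax xy yb hc.
have [|||c cs|m hm] := hs (x - k) (y - k); [lra | lra | lra | |].
  have := hc (c + k) (map_f _ cs); lra.
have e' z : x <= z <= y -> g' z = g (z - k) by move=> ?; rewrite -e ?subrK //; lra.
exists m => z hz; rewrite !e' ?lexx ?xy // hm; [ring | lra].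
Qed.

Lemma pl_on_ext a b g g' : (forall t, a <= t <= b -> g' t = g t) ->
  pl_on a b g -> pl_on a b g'.
Proof.
move=> e plg; have := @pl_on_shift a b g g' 0 _ plg; rewrite !addr0; apply=> t ht.
by rewrite addr0 e.
Qed.

Lemma pl_on_cat a b c g : a <= b -> b <= c ->
  pl_on a b g -> pl_on b c g -> pl_on a c g.
Proof.
move=> ab bc [s1 h1] [s2 h2]; exists (b :: s1 ++ s2) => x y ax xy yc hs.
have hb := hs b (mem_head _ _).
have [yb|by_] := lerP y b.
  by apply: h1 => // k ks; apply: hs; rewrite inE mem_cat ks orbT.
apply: h2 => //; first by move: hb; lra.
by move=> k ks; apply: hs; rewrite inE mem_cat ks !orbT.
Qed.

Lemma pl_on_affine a b g (k : R) m : (forall t, a <= t <= b -> g t = k + m%:~R * t) ->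
  pl_on a b g.
Proof.
move=> e; exists [::] => x y ax xy yb _; exists m => z hz.
by rewrite !e; [ring | lra | lra].
Qed.

Definition has_slope_up g t m := exists2 eps : R, 0 < eps &
  forall h, 0 <= h <= eps -> g (t + h) = g t + m%:~R * h.

Definition has_slope_down g t m := exists2 eps : R, 0 < eps &
  forall h, 0 <= h <= eps -> g (t - h) = g t + m%:~R * h.

Lemma has_slope_up_uniq g t m m' : has_slope_up g t m -> has_slope_up g t m' -> m = m'.
Proof.
move=> [d d0 hd] [e e0 he]; pose x := Num.min d e.
have x0 : 0 < x by rewrite lt_min d0.
have xd : x <= d by rewrite ge_min lexx.
have xe : x <= e by rewrite ge_min lexx orbT.
have := hd x; rewrite he ?(ltW x0) // => /(_ xd)/addrI/(mulIf (lt0r_neq0 x0)).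
by move/intr_inj.
Qed.

Lemma slope_upE g t m : has_slope_up g t m -> slope_up g t = m.
Proof.
move=> h; have h' := @xgetPex _ 0 (has_slope_up g t) (ex_intro _ m h).
exact: has_slope_up_uniq h' h.
Qed.

Lemma slope_downE g t m : has_slope_down g t m -> slope_down g t = m.
Proof.
move=> [d d0 hd]; apply: slope_upE; exists d => // h hh.
by rewrite opprD !opprK hd.
Qed.

(** Slopes depend on germs only; the base points may differ, which covers
    reparametrizations by a shift. *)
Lemma slope_up_germ g1 g2 t1 t2 (d : R) : 0 < d ->
  (forall h, 0 <= h <= d -> g1 (t1 + h) = g2 (t2 + h)) ->
  slope_up g1 t1 = slope_up g2 t2.
Proof.
move=> d0 e; rewrite /slope_up; congr (xget 0 _).
apply/seteqP; split=> m [eps eps0 h]; exists (Num.min d eps);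
  rewrite ?lt_min ?d0 // => x; rewrite le_min => /and3P[x0 xd xe].
- have := e 0; rewrite !addr0 lexx ltW // => /(_ isT) <-.
  by rewrite -e ?x0 // h ?x0.
- have := e 0; rewrite !addr0 lexx ltW // => /(_ isT) ->.
  by rewrite e ?x0 // h ?x0.
Qed.

Lemma slope_down_germ g1 g2 t1 t2 (d : R) : 0 < d ->
  (forall h, 0 <= h <= d -> g1 (t1 - h) = g2 (t2 - h)) ->
  slope_down g1 t1 = slope_down g2 t2.
Proof.
move=> d0 e; apply: (slope_up_germ d0) => h hh; rewrite !opprD !opprK.
exact: e.
Qed.

Lemma slope_down_opp g t : slope_down (fun x => g (- x)) (- t) = slope_up g t.
Proof.
by apply: (@slope_up_germ _ _ _ _ 1) => // h _; rewrite !opprK.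
Qed.

Lemma pl_slope_up a b g t : pl_on a b g -> a <= t < b ->
  has_slope_up g t (slope_up g t).
Proof.
move=> [s hs] /andP[at_ tb]; have [d d0 hd] := seq_isolated s t.
pose y := Num.min b (t + d).
have ty : t < y by rewrite lt_min tb ltrDl.
have yb : y <= b by rewrite ge_min lexx.
have yd : y <= t + d by rewrite ge_min lexx orbT.
have [|m hm] := hs t y at_ (ltW ty) yb.
  move=> c cs; apply/negP => /andP[tc cy].
  have := hd c cs (negbT (gt_eqF tc)); rewrite gtr0_norm ?subr_gt0 //; lra.
suff h : has_slope_up g t m by rewrite (slope_upE h).
exists (y - t); first by rewrite subr_gt0.
by move=> h hh; rewrite hm; [ring | lra].
Qed.

Lemma slope_upB a b g1 g2 t : pl_on a b g1 -> pl_on a b g2 -> a <= t < b ->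
  slope_up (fun x => g1 x - g2 x) t = slope_up g1 t - slope_up g2 t.
Proof.
move=> p1 p2 ht; apply: slope_upE.
have [d d0 hd] := pl_slope_up p1 ht; have [e e0 he] := pl_slope_up p2 ht.
exists (Num.min d e); first by rewrite lt_min d0.
move=> h; rewrite le_min => /and3P[h0 h1 h2].
by rewrite hd ?h0 // he ?h0 // rmorphB /=; ring.
Qed.

Lemma slope_downB a b g1 g2 t : pl_on a b g1 -> pl_on a b g2 -> a < t <= b ->
  slope_down (fun x => g1 x - g2 x) t = slope_down g1 t - slope_down g2 t.
Proof.
move=> /pl_on_opp p1 /pl_on_opp p2 ht; apply: (slope_upB p1 p2); lra.
Qed.

Definition kink g t : int := slope_up g t + slope_down g t.

(** Slopes can only increase at the breakpoints, so the function lies above each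
    of its tangents. *)
Lemma pl_convex a b g x y : pl_on a b g -> a <= x -> x < y -> y <= b ->
  (forall t, x < t < y -> 0 <= kink g t) ->
  g x + (slope_up g x)%:~R * (y - x) <= g y /\ slope_up g x <= - slope_down g y.
Proof.
move=> plg; have [s hs] := plg.
have [n] := ubnP (size [seq c <- s | x < c < y]).
elim: n x y => // n IH x y lt ax xy yb convex.
have [/hasP[c cs cxy]|/hasPn none] := boolP (has (fun c => x < c < y) s).
  have /andP[xc cy] := cxy.
  have less (P : pred R) : {subset P <= (fun c => x < c < y)} -> ~~ P c ->
      (size [seq c <- s | P c] < n)%N.
    move=> sub nP; rewrite -ltnS; apply: leq_ltn_trans lt.
    have count_rem (Q : pred R) : count Q s = (Q c + count Q (rem c s))%N.
      by rewrite (permP (perm_to_rem cs)).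
    rewrite !size_filter !count_rem (negPf nP) cxy add0n add1n ltnS.
    exact: sub_count.
  have [|||||h1 h1'] := IH x c; [|lra|lra|lra| |].
  - by apply: less => [z /andP[xz zc]|]; rewrite ?ltxx ?andbF // -topredE /=; lra.
  - by move=> t ht; apply: convex; lra.
  have [|||||h2 h2'] := IH c y; [|lra|lra|lra| |].
  - by apply: less => [z /andP[xz zc]|]; rewrite ?ltxx // -topredE /=; lra.
  - by move=> t ht; apply: convex; lra.
  have mono : slope_up g x <= slope_up g c.
    by apply: le_trans h1' _; have := convex c cxy; rewrite /kink; lia.
  split; last exact: le_trans h2'.
  apply: le_trans h2; have : (slope_up g x)%:~R <= (slope_up g c)%:~R :> R.
    by rewrite ler_int.
  move: h1; set u := (slope_up g x)%:~R; set v := (slope_up g c)%:~R => h1 uv.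
  have : u * (y - c) <= v * (y - c) by rewrite ler_wpM2r // subr_ge0 ltW.
  lra.
have [m hm] := hs x y ax (ltW xy) yb none.
rewrite (@slope_upE _ _ m) ?(@slope_downE _ _ (- m)) ?opprK.
- by split=> //; rewrite [g y]hm // lexx ltW.
- exists (y - x); first by rewrite subr_gt0.
  move=> h hh; rewrite (hm (y - h)) ?(hm y) ?rmorphN /=; [ring | lra | lra].
- exists (y - x); first by rewrite subr_gt0.
  by move=> h hh; rewrite hm; [ring | lra].
Qed.

Lemma pl_convex_up a b g x y : pl_on a b g -> a <= x -> x < y -> y <= b ->
  (forall t, x < t < y -> 0 <= kink g t) ->
  g x + (slope_up g x)%:~R * (y - x) <= g y.
Proof. by move=> h1 h2 h3 h4 h5; case: (pl_convex h1 h2 h3 h4 h5). Qed.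

(** The statement at the right end, by reflection. *)
Lemma pl_convex_down a b g x y : pl_on a b g -> a <= x -> x < y -> y <= b ->
  (forall t, x < t < y -> 0 <= kink g t) ->
  g y + (slope_down g y)%:~R * (y - x) <= g x.
Proof.
move=> /pl_on_opp plg ax xy yb convex.
have [||||h _] := pl_convex plg (x := - y) (y := - x); [lra|lra|lra| |].
  move=> t ht; have := convex (- t); rewrite /kink addrC.
  rewrite -(slope_down_opp g) opprK {1}/slope_down opprK; apply; lra.
by move: h; rewrite !opprK -/(slope_down g y); lra.
Qed.

(** Without kinks the function is both convex and concave. *)
Lemma pl_straight a b g : pl_on a b g -> a < b ->
  (forall t, a < t < b -> kink g t = 0) -> slope_up g a + slope_down g b = 0.
Proof.
move=> plg ab straight; have plN := pl_onB (pl_on_cst a b 0) plg.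
have pl0 := pl_on_cst a b 0.
have up0 (t : R) : slope_up (fun=> 0 : R) t = 0.
  by apply: slope_upE; exists 1 => // h _; rewrite mul0r addr0.
have down0 (t : R) : slope_down (fun=> 0 : R) t = 0.
  by apply: slope_downE; exists 1 => // h _; rewrite mul0r addr0.
have [||||_ h1] := pl_convex plg (x := a) (y := b); [lra|lra|lra| |].
  by move=> t /straight ->.
have [||||_ h2] := pl_convex plN (x := a) (y := b); [lra|lra|lra| |].
  move=> t ht; rewrite /kink (slope_upB pl0 plg) ?(slope_downB pl0 plg); try lra.
  by rewrite up0 down0; have := straight t ht; rewrite /kink; lia.
move: h1 h2; rewrite (slope_upB pl0 plg) ?(slope_downB pl0 plg); try lra.
by rewrite up0 down0; lia.
Qed.

Lemma pl_kink_finite a b g : pl_on a b g ->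
  exists s : seq R, forall t, a < t < b -> kink g t != 0 -> t \in s.
Proof.
move=> [s hs]; exists s => t htb; apply: contraNT => ts.
have [d d0 hd] := seq_isolated s t.
pose e := Num.min d (Num.min (t - a) (b - t)).
have e0 : 0 < e by rewrite !lt_min d0 !subr_gt0.
have ed : e <= d by rewrite ge_min lexx.
have ea : e <= t - a by rewrite !ge_min lexx !orbT.
have eb : e <= b - t by rewrite !ge_min lexx !orbT.
have [||||m hm] := hs (t - e) (t + e); [lra|lra|lra| |].
  move=> c cs; apply/negP => hc; have ct : c != t by apply: contraNneq ts => <-.
  by have := hd c cs ct; case: ler0P => _; lra.
apply/eqP; rewrite /kink (@slope_upE _ _ m) ?(@slope_downE _ _ (- m)); first by lia.
- exists e => // h hh; rewrite (hm (t - h)) ?(hm t) ?rmorphN /=; [ring|lra|lra].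
- exists e => // h hh; rewrite (hm (t + h)) ?(hm t) /=; [ring|lra|lra].
Qed.

(** The largest convex function with integer slopes on [0, l] that takes the
    values [u] and [v] at the ends: only the two integer slopes around the mean
    slope are used. *)
Definition chord_slope (l u v : R) : int := Num.floor ((v - u) / l).

Definition convex_chord (l u v : R) (t : R) : R :=
  Num.max (u + (chord_slope l u v)%:~R * t)
          (v - (chord_slope l u v + 1)%:~R * (l - t)).

Section Chord.
Variables (l u v : R).
Hypothesis l0 : 0 < l.
Local Notation n := (chord_slope l u v).
Local Notation c := (convex_chord l u v).
Let t0 := u - v + (n + 1)%:~R * l.

Let t0_itv : 0 < t0 <= l.
Proof.
have := floor_itv ((v - u) / l); rewrite -/n ler_pdivlMr // ltr_pdivrMr //.
by rewrite /t0 rmorphD /= mulrDl mul1r; lra.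
Qed.

Let chord_left t : t <= t0 -> c t = u + n%:~R * t.
Proof.
rewrite /t0 /convex_chord => h; apply/max_idPl; move: h.
by rewrite rmorphD /= !(mulrDl, mulrBr) !mul1r; lra.
Qed.

Let chord_right t : t0 <= t -> c t = v - (n + 1)%:~R * (l - t).
Proof.
rewrite /t0 /convex_chord => h; apply/max_idPr; move: h.
by rewrite rmorphD /= !(mulrDl, mulrBr) !mul1r; lra.
Qed.

Lemma convex_chord0 : c 0 = u.
Proof. by rewrite chord_left; [rewrite mulr0 addr0 | case/andP: t0_itv => /ltW]. Qed.

Lemma convex_chord1 : c l = v.
Proof. by rewrite chord_right ?subrr ?mulr0 ?subr0 //; case/andP: t0_itv. Qed.

Lemma convex_chord_pl : pl_on 0 l c.
Proof.
have /andP[h1 h2] := t0_itv; apply: (@pl_on_cat _ t0) => //; first exact: ltW.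
  by apply: (@pl_on_affine _ _ _ u n) => t /andP[_]; apply: chord_left.
apply: (@pl_on_affine _ _ _ (v - (n + 1)%:~R * l) (n + 1)) => t /andP[ht _].
by rewrite chord_right //; ring.
Qed.

Lemma convex_chord_up : slope_up c 0 = n.
Proof.
apply: slope_upE; exists t0; first by case/andP: t0_itv.
by move=> h /andP[_ hh]; rewrite add0r convex_chord0 chord_left.
Qed.

Lemma convex_chord_down : chord_slope l v u <= slope_down c l.
Proof.
have /andP[h1 h2] := t0_itv; have [e|ne] := eqVneq t0 l.
  rewrite (@slope_downE _ _ (- n)); last first.
    exists l => // h hh; rewrite convex_chord1 chord_left ?e; last by lra.
    have : v = u + n%:~R * l by rewrite -chord_left ?e // convex_chord1.
    by rewrite rmorphN /=; move: (n%:~R : R) => N ->; ring.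
  rewrite -ltzD1 floor_lt_int ltr_pdivrMr //.
  move: e; rewrite /t0 !rmorphD rmorphN /= !mulrDl mulNr !mul1r; lra.
have lt : t0 < l by rewrite lt_neqAle ne.
rewrite (@slope_downE _ _ (- (n + 1))); last first.
  exists (l - t0); first by rewrite subr_gt0.
  move=> h hh; rewrite convex_chord1 chord_right; last by lra.
  by rewrite rmorphN /=; ring.
rewrite -ltzD1 floor_lt_int ltr_pdivrMr //.
move: lt; rewrite /t0 !rmorphD rmorphN rmorphD /= !mulrDl !mulNr !mulrDl !mul1r; lra.
Qed.

Lemma convex_chord_kink t : 0 < t < l -> 0 <= kink c t.
Proof.
move=> ht; have [lt|lt|e] := ltgtP t t0.
- rewrite /kink (@slope_upE _ _ n) ?(@slope_downE _ _ (- n)) ?subrr //.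
    exists t; first by case/andP: ht.
    move=> h hh; rewrite !chord_left ?rmorphN /=; [ring|lra|lra].
  exists (t0 - t); first by rewrite subr_gt0.
  by move=> h hh; rewrite !chord_left /=; [ring|lra|lra].
- rewrite /kink (@slope_upE _ _ (n + 1)) ?(@slope_downE _ _ (- (n + 1))) ?subrr //.
    exists (t - t0); first by rewrite subr_gt0.
    move=> h hh; rewrite !chord_right ?rmorphN /=; [ring|lra|lra].
  exists 1 => // h hh; rewrite !chord_right /=; [ring|lra|lra].
- rewrite /kink (@slope_upE _ _ (n + 1)) ?(@slope_downE _ _ (- n)); first lia.
    exists t; first by case/andP: ht.
    move=> h hh; rewrite !chord_left ?rmorphN /=; [ring|lra|lra].
  exists 1 => // h hh; rewrite !chord_right /=; [ring|lra|lra].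
Qed.

(** A tangent of slope at most [n] bounds [g] through its value at [0], a
    steeper one through its value at [l]. *)
Lemma convex_chord_max g t : pl_on 0 l g -> g 0 <= u -> g l <= v ->
  (forall x, 0 < x < l -> 0 <= kink g x) -> 0 < t < l -> g t <= c t.
Proof.
move=> plg g0 gl convex ht.
have h1 : g t + (slope_down g t)%:~R * (t - 0) <= g 0.
  by apply: (pl_convex_down plg); try lra; move=> x hx; apply: convex; lra.
have h2 : g t + (slope_up g t)%:~R * (l - t) <= g l.
  by apply: (pl_convex_up plg); try lra; move=> x hx; apply: convex; lra.
have := convex t ht; rewrite /kink; set p := slope_up g t in h2 *.
set q := slope_down g t in h1 *; move=> pq; rewrite /convex_chord le_max.
have [pn|np] := lerP p n; apply/orP; [left|right].
  have : (- n)%:~R <= q%:~R :> R by rewrite ler_int; lia.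
  rewrite rmorphN /= => nq.
  have : - n%:~R * t <= q%:~R * t by apply: ler_wpM2r => //; lra.
  lra.
have : (n + 1)%:~R <= p%:~R :> R by rewrite ler_int; lia.
move=> nq; have : (n + 1)%:~R * (l - t) <= p%:~R * (l - t).
  by apply: ler_wpM2r => //; lra.
lra.
Qed.

End Chord.
End PiecewiseLinear.
(** * Rational functions on a metric graph *)

Section MetricFunctions.
Variables (R : realType) (G : mgraph R).
Implicit Types (f g : mpoint G -> R) (e : edge G) (v : vertex G) (p : mpoint G).

Local Notation mdivisor := (@divisor (Metric R) G).

Definition edge_fun f e (t : R) : R := f (pt e t).

Lemma pt_interior e (t : R) (h : 0 < t < len e) :
  pt e t = inr (exist (fun x : edge G * R => 0 < x.2 < len x.1) (e, t) h).
Proof. by rewrite /pt insubT. Qed.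

Lemma pt_tail e : pt e 0 = inl (tail e).
Proof. by rewrite /pt insubF /= ?lexx // ltxx. Qed.

Lemma pt_head e : pt e (len e) = inl (head e).
Proof. by rewrite /pt insubF /= ?ltxx ?andbF // leNgt len_gt0. Qed.

Lemma mpoint_ind (P : mpoint G -> Prop) : (forall v, P (inl v)) ->
  (forall e (t : R), 0 < t < len e -> P (pt e t)) -> forall p, P p.
Proof.
move=> Pv Pe [v|[[e t] ht]]; first exact: Pv.
by have := Pe e t ht; rewrite pt_interior.
Qed.

Lemma pt_neq_vertex e (t : R) v : 0 < t < len e -> pt e t <> inl v.
Proof. by move=> ht; rewrite pt_interior. Qed.

Definition dart_slope f (h : dart G) : int :=
  if h.2 then slope_down (edge_fun f h.1) (len h.1) else slope_up (edge_fun f h.1) 0.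

Lemma ord_at_vertex f v : ord_at f (inl v) = \sum_(h | src h == v) dart_slope f h.
Proof. by rewrite sum_darts. Qed.

Lemma ord_at_pt f e (t : R) : 0 < t < len e -> ord_at f (pt e t) = kink (edge_fun f e) t.
Proof. by move=> ht; rewrite pt_interior. Qed.

Lemma rational_cst (c : R) : rational_function (fun _ : mpoint G => c).
Proof. by move=> e; apply: pl_on_cst. Qed.

Lemma rationalB f g : rational_function f -> rational_function g ->
  rational_function (fun p => f p - g p).
Proof. by move=> hf hg e; apply: (pl_onB (hf e) (hg e)). Qed.

Lemma dart_slopeB f g h : rational_function f -> rational_function g ->
  dart_slope (fun p => f p - g p) h = dart_slope f h - dart_slope g h.
Proof.
move=> hf hg; rewrite /dart_slope; case: h => e [] /=; have l0 := len_gt0 e.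
  by apply: (slope_downB (hf e) (hg e)); rewrite l0 lexx.
by apply: (slope_upB (hf e) (hg e)); rewrite l0 lexx.
Qed.

Lemma ord_atB f g p : rational_function f -> rational_function g ->
  ord_at (fun x => f x - g x) p = ord_at f p - ord_at g p.
Proof.
move=> hf hg; elim/mpoint_ind: p => [v|e t ht].
  by rewrite !ord_at_vertex -sumrB; apply: eq_bigr => h _; apply: dart_slopeB.
have /andP[t0 tl] := ht.
rewrite !ord_at_pt // /kink (slope_upB (hf e) (hg e)) ?tl ?ltW //.
rewrite (slope_downB (hf e) (hg e)) ?t0 ?ltW //; ring.
Qed.

Lemma ord_at_cst (c : R) p : ord_at (fun _ : mpoint G => c) p = 0.
Proof.
have slope0 t : slope_up (fun=> c) t = 0 :> int.
  by apply: slope_upE; exists 1 => // h _; rewrite mul0r addr0.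
have slope0' t : slope_down (fun=> c) t = 0 :> int.
  by apply: slope_downE; exists 1 => // h _; rewrite mul0r addr0.
elim/mpoint_ind: p => [v|e t ht]; last by rewrite ord_at_pt // /kink slope0 slope0'.
rewrite ord_at_vertex big1 // => h _; rewrite /dart_slope.
by case: ifP => _; [apply: slope0' | apply: slope0].
Qed.

Lemma rationalN f : rational_function f -> rational_function (fun p => - f p).
Proof.
move=> hf e; apply: pl_on_ext (pl_onB (pl_on_cst 0 (len e) 0) (hf e)) => t _.
by rewrite sub0r.
Qed.

Lemma ord_atN f p : rational_function f -> ord_at (fun x => - f x) p = - ord_at f p.
Proof.
move=> hf; rewrite -[RHS]sub0r -(ord_at_cst 0 p) -ord_atB //.
  by congr (ord_at _ p); apply/funext => x; rewrite sub0r.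
exact: rational_cst.
Qed.

Lemma rationalD f g : rational_function f -> rational_function g ->
  rational_function (fun p => f p + g p).
Proof.
move=> hf hg e; apply: pl_on_ext (rationalB hf (rationalN hg) e) => t _.
by rewrite opprK.
Qed.

Lemma ord_atD f g p : rational_function f -> rational_function g ->
  ord_at (fun x => f x + g x) p = ord_at f p + ord_at g p.
Proof.
move=> hf hg; have := ord_atB p hf (rationalN hg); rewrite ord_atN // opprK => <-.
by congr (ord_at _ p); apply/funext => x; rewrite opprK.
Qed.

Lemma principal_divisor_exists f : rational_function f ->
  exists D : mdivisor, forall p : mpoint G, coeff p D = ord_at f p.
Proof.
move=> hf; have /choice[s hs] : forall e, exists s : seq R, forall t : R,
    0 < t < len e -> kink (edge_fun f e) t != 0 -> t \in s.
  by move=> e; apply: pl_kink_finite (hf e).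
pose S := undup ([seq inl v | v <- enum (vertex G)]
  ++ flatten [seq [seq pt e t | t <- s e] | e <- enum (edge G)]).
exists (\sum_(p <- S) << ord_at f p *g p >>) => p; rewrite raddf_sum /=.
have [pS|pS] := boolP (p \in S).
  rewrite (big_rem p) //= coeffU eqxx mulr1 big1_seq ?addr0 // => q /andP[_ qS].
  rewrite coeffU; case: eqP => [e|_]; last by rewrite mulr0.
  by move: qS; rewrite e mem_rem_uniqF ?undup_uniq.
rewrite big1_seq => [|q /andP[_ qS]]; last first.
  by rewrite coeffU; case: eqP qS pS => [-> ->|_]; rewrite ?mulr0.
apply/esym/eqP; apply: contraNT pS; elim/mpoint_ind: p => [v|e t ht] nz.
  by rewrite mem_undup mem_cat map_f // mem_enum.
rewrite mem_undup mem_cat; apply/orP; right; apply/flatten_mapP.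
exists e; first by rewrite mem_enum.
by apply/map_f/hs => //; rewrite -ord_at_pt.
Qed.

Lemma metric_equiv_effectiveP (D : mdivisor) : equiv_effective D <->
  exists2 f, rational_function f & forall p : mpoint G, 0 <= coeff p D + ord_at f p.
Proof.
split=> [[E effE [f rf hf]]|[f rf hf]].
  exists (fun x => - f x); first exact: rationalN.
  by move=> p; rewrite ord_atN // -hf coeffB opprB addrC subrK.
have [P hP] := principal_divisor_exists rf; exists (D + P).
  by move=> p; rewrite coeffD hP.
exists (fun x => - f x); first exact: rationalN.
by move=> p; rewrite ord_atN // opprD addrA subrr sub0r coeffN hP.
Qed.

Definition convex_on_edges f : Prop :=
  forall e (t : R), 0 < t < len e -> 0 <= ord_at f (pt e t).

Local Notation flap := (@floor_laplacian G R (@len R G)).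

(** On each edge the function lies above its tangents at the two ends. *)
Lemma ord_at_le_floor f v : rational_function f -> convex_on_edges f ->
  ord_at f (inl v) <= flap (fun w => f (inl w)) v.
Proof.
move=> rf cf; rewrite ord_at_vertex; apply: ler_sum => -[e b] _.
have convex t : 0 < t < len e -> 0 <= kink (edge_fun f e) t.
  by move=> ht; rewrite -ord_at_pt //; apply: cf.
have l0 := len_gt0 e; rewrite /floor_slope floor_ge_int /= ler_pdivlMr //.
rewrite /dart_slope /src /dst; case: b => /=.
  have := pl_convex_down (rf e) (lexx 0) l0 (lexx _) convex.
  rewrite /edge_fun pt_tail pt_head subr0; lra.
have := pl_convex_up (rf e) (lexx 0) l0 (lexx _) convex.
rewrite /edge_fun pt_tail pt_head subr0; lra.
Qed.

Definition chord_extension (F : vertex G -> R) (p : mpoint G) : R :=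
  match p with
  | inl v => F v
  | inr x => let: (e, t) := \val x in convex_chord (len e) (F (tail e)) (F (head e)) t
  end.

Section ChordExtension.
Variable F : vertex G -> R.

Lemma chord_extension_pt e (t : R) : 0 <= t <= len e ->
  chord_extension F (pt e t) = convex_chord (len e) (F (tail e)) (F (head e)) t.
Proof.
have l0 := len_gt0 e; move=> /andP[t0 tl].
have [->|tn0] := eqVneq t 0; first by rewrite pt_tail convex_chord0.
have [->|tnl] := eqVneq t (len e); first by rewrite pt_head convex_chord1.
have ht : 0 < t < len e by rewrite !lt_neqAle eq_sym tn0 t0 tnl tl.
by rewrite pt_interior.
Qed.

Lemma chord_extension_rational : rational_function (chord_extension F).
Proof.
move=> e; apply: pl_on_ext (convex_chord_pl _ _ (len_gt0 e)) => t ht.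
exact: chord_extension_pt.
Qed.

Lemma chord_extension_convex : convex_on_edges (chord_extension F).
Proof.
move=> e t ht; have := convex_chord_kink (F (tail e)) (F (head e)) (len_gt0 e) ht.
rewrite ord_at_pt // /kink; congr (0 <= _ + _); have /andP[t0 tl] := ht.
  apply: (@slope_up_germ _ _ _ _ _ (len e - t)); first by rewrite subr_gt0.
  by move=> h hh; rewrite /edge_fun chord_extension_pt //; lra.
apply: (@slope_down_germ _ _ _ _ _ t) => // h hh.
by rewrite /edge_fun chord_extension_pt //; lra.
Qed.

Lemma chord_extension_ord v : flap F v <= ord_at (chord_extension F) (inl v).
Proof.
rewrite ord_at_vertex; apply: ler_sum => -[e b] _; have l0 := len_gt0 e.
rewrite /floor_slope /dart_slope /src /dst; case: b => /=.
  apply: le_trans (convex_chord_down (F (tail e)) (F (head e)) l0) _.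
  rewrite le_eqVlt; apply/orP; left; apply/eqP.
  apply: (@slope_down_germ _ _ _ _ _ (len e)) => // h hh.
  by rewrite /edge_fun chord_extension_pt //; lra.
rewrite -/(chord_slope _ _ _) -(convex_chord_up _ _ l0).
rewrite le_eqVlt; apply/orP; left; apply/eqP.
apply: (@slope_up_germ _ _ _ _ _ (len e)) => // h hh.
by rewrite /edge_fun chord_extension_pt //; lra.
Qed.

(** Used to compare functions at the interior points of the edges when only
    their values at the vertices have been compared. *)
Lemma chord_extension_max g : rational_function g -> convex_on_edges g ->
  (forall v, g (inl v) <= F v) -> forall p, g p <= chord_extension F p.
Proof.
move=> rg cg gF p; elim/mpoint_ind: p => [v|e t ht]; first exact: gF.
have /andP[t0 tl] := ht; rewrite chord_extension_pt; last by rewrite !ltW.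
rewrite -[g _]/(edge_fun g e t).
apply: (convex_chord_max (len_gt0 e) (rg e)) => //.
- by rewrite /edge_fun pt_tail.
- by rewrite /edge_fun pt_head.
- by move=> x hx; rewrite -ord_at_pt //; apply: cg.
Qed.

End ChordExtension.

Definition vertex_supported (D : mdivisor) : Prop :=
  forall e (t : R), 0 < t < len e -> coeff (pt e t) D = 0.

Lemma deg_vertex_supported (D : mdivisor) : vertex_supported D ->
  deg D = \sum_v coeff (inl v : mpoint G) D.
Proof.
move=> hD; pose s : seq (mpoint G) := [seq inl v | v <- index_enum (vertex G)].
rewrite (@deg_sum (Metric R) G D s).
- by rewrite big_map.
- by rewrite map_inj_uniq ?index_enum_uniq // => x y [].
move=> p; rewrite mem_dom; elim/mpoint_ind: p => [v _|e t ht].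
  by apply: map_f; rewrite mem_index_enum.
by rewrite hD // eqxx.
Qed.

(** Without kinks inside the edges the two outgoing slopes of an edge cancel. *)
Lemma sum_ord_straight f : rational_function f ->
  (forall e (t : R), 0 < t < len e -> ord_at f (pt e t) = 0) ->
  \sum_v ord_at f (inl v) = 0.
Proof.
move=> rf hf; under eq_bigr => v _ do rewrite ord_at_vertex.
rewrite sum_vertices_darts big1 // => e _; rewrite /dart_slope /= addrC.
apply: (pl_straight (rf e) (len_gt0 e)) => t ht.
by rewrite -ord_at_pt // hf.
Qed.

Definition metric_vertex_divisor (c : vertex G -> int) : mdivisor :=
  \sum_(v : vertex G) << c v *g (inl v : mpoint G) >>.

Lemma coeff_metric_vertex_divisor c v :
  coeff (inl v : mpoint G) (metric_vertex_divisor c) = c v.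
Proof.
rewrite raddf_sum /= (bigD1 v) //= coeffU eqxx mulr1 big1 ?addr0 // => w wv.
rewrite coeffU; case: eqP => [[e]|_]; last by rewrite mulr0.
by rewrite e eqxx in wv.
Qed.

Lemma metric_vertex_divisor_supported c : vertex_supported (metric_vertex_divisor c).
Proof.
move=> e t ht; rewrite raddf_sum big1 //= => v _; rewrite coeffU.
by case: eqP => [e'|]; rewrite ?mulr0 //; case: (pt_neq_vertex ht (esym e')).
Qed.

Lemma deg_mcanonical : deg (mcanonical G) = 2 * (#|edge G|%:Z - #|vertex G|%:Z).
Proof.
have -> : mcanonical G = metric_vertex_divisor (fun v => (val v)%:Z - 2) by [].
rewrite deg_vertex_supported; last exact: metric_vertex_divisor_supported.
under eq_bigr => v _ do rewrite coeff_metric_vertex_divisor.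
by rewrite sumrB -(big_morph Posz PoszD erefl) /= sum_val sum_const_int PoszM; ring.
Qed.

End MetricFunctions.
(** * Changing the model of a metric graph *)

Lemma big_option (A : nmodType) (T : finType) (P : pred (option T)) (F : option T -> A) :
  \sum_(x | P x) F x = (if P None then F None else 0) + \sum_(x | P (Some x)) F (Some x).
Proof.
rewrite big_mkcond (bigD1 None) //=; congr (_ + _).
rewrite [RHS]big_mkcond (reindex_omap Some id) /=; last by case.
by apply: eq_bigl => x; rewrite eqxx.
Qed.

Definition model_refinement (R : realType) (G H : mgraph R)
    (phi : mpoint G -> mpoint H) : Prop :=
  [/\ bijective phi,
      forall f : mpoint H -> R, rational_function f <-> rational_function (f \o phi),
      forall (f : mpoint H -> R) p, ord_at (f \o phi) p = ord_at f (phi p),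
      forall v, exists w, phi (inl v) = inl w &
      forall p, coeff (phi p) (mcanonical H) = coeff p (mcanonical G)].

Lemma refinement_id (R : realType) (G : mgraph R) : model_refinement (@id (mpoint G)).
Proof. by split=> //; [exists id | move=> v; exists v]. Qed.

Lemma refinement_comp (R : realType) (G H K : mgraph R)
    (phi : mpoint G -> mpoint H) (psi : mpoint H -> mpoint K) :
  model_refinement phi -> model_refinement psi -> model_refinement (psi \o phi).
Proof.
move=> [b1 r1 o1 v1 k1] [b2 r2 o2 v2 k2]; split.
- exact: bij_comp.
- by move=> f; rewrite r2 r1.
- by move=> f p; rewrite -[ord_at _ p]/(ord_at ((f \o psi) \o phi) p) o1 o2.
- by move=> v; have [w e] := v1 v; have [x e'] := v2 w; exists x; rewrite /= e.
- by move=> p; rewrite k2 k1.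
Qed.

Section Subdivide.
Variables (R : realType) (G : mgraph R) (e0 : edge G) (t0 : R).
Hypothesis ht0 : 0 < t0 < len e0.

Local Notation H := (subdiv ht0).
Local Notation phi := (@subdiv_point R G e0 t0 ht0).

Let len_some e : @len R H (Some e) = if e == e0 then t0 else len e. Proof. by []. Qed.
Let len_none : @len R H None = len e0 - t0. Proof. by []. Qed.

Lemma subdiv_point_other e (t : R) : e != e0 -> 0 <= t <= len e ->
  phi (pt e t) = @pt R H (Some e) t.
Proof.
move=> ne /andP[h0 hl]; have [->|n0] := eqVneq t 0; first by rewrite !pt_tail.
have [->|nl] := eqVneq t (len e).
  have -> : len e = @len R H (Some e) by rewrite len_some (negPf ne).
  by rewrite pt_head len_some (negPf ne) pt_head /= (negPf ne).
have ht : 0 < t < len e by rewrite !lt_neqAle eq_sym n0 h0 nl hl.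
by rewrite pt_interior /= (negPf ne).
Qed.

Lemma subdiv_point_left (t : R) : 0 <= t <= t0 -> phi (pt e0 t) = @pt R H (Some e0) t.
Proof.
have /andP[t00 t0l] := ht0.
move=> /andP[h0 hl]; have [->|n0] := eqVneq t 0; first by rewrite !pt_tail.
have t_gt0 : 0 < t by rewrite lt_neqAle eq_sym n0.
have ht : 0 < t < len e0 by lra.
by rewrite pt_interior /= eqxx hl.
Qed.

Lemma subdiv_point_right (t : R) : t0 <= t <= len e0 ->
  phi (pt e0 t) = @pt R H None (t - t0).
Proof.
move=> /andP[h0 hl]; have /andP[t00 t0l] := ht0.
have [->|n0] := eqVneq t t0.
  rewrite subrr pt_tail subdiv_point_left ?lexx ?ltW //.
  transitivity (@pt R H (Some e0) (@len R H (Some e0))).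
    by congr pt; rewrite len_some eqxx.
  by rewrite pt_head /= eqxx.
have [->|nl] := eqVneq t (len e0); first by rewrite -len_none !pt_head.
have t_gt : t0 < t by rewrite lt_neqAle eq_sym n0.
have t_lt : t < len e0 by rewrite lt_neqAle nl.
have ht : 0 < t < len e0 by lra.
by rewrite pt_interior /= eqxx leNgt t_gt.
Qed.

Definition unsubdivide (p : mpoint H) : mpoint G :=
  match p with
  | inl (Some v) => inl v
  | inl None => pt e0 t0
  | inr x => match \val x with
             | (Some e, t) => pt e t
             | (None, t) => pt e0 (t + t0)
             end
  end.

Lemma subdiv_pointK : cancel phi unsubdivide.
Proof.
have /andP[t00 t0l] := ht0; move=> p; elim/mpoint_ind: p => [v //|e t ht].
have /andP[h0 hl] := ht; have [ee|ne] := eqVneq e e0; last first.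
  rewrite subdiv_point_other // ?(ltW h0) ?(ltW hl) // pt_interior //.
  by rewrite len_some (negPf ne).
subst e; have [lt|gt|->] := ltgtP t t0.
- by rewrite subdiv_point_left ?(ltW h0) ?(ltW lt) // pt_interior // len_some eqxx h0.
- rewrite subdiv_point_right ?(ltW gt) ?(ltW hl) // pt_interior.
    by rewrite len_none; lra.
  by move=> h /=; rewrite subrK.
- by rewrite subdiv_point_right ?lexx ?ltW // subrr pt_tail.
Qed.

Lemma unsubdivideK : cancel unsubdivide phi.
Proof.
have /andP[t00 t0l] := ht0; move=> p; elim/mpoint_ind: p => [[v|] //|e t ht].
  by rewrite subdiv_point_right ?lexx ?ltW // subrr pt_tail.
rewrite {1}pt_interior /=; case: e ht => [e|] ht.
  have := ht; rewrite len_some; case: eqP => [->|/eqP ne] /andP[h0 hl].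
    by rewrite subdiv_point_left // (ltW h0) ltW.
  by rewrite subdiv_point_other // (ltW h0) ltW.
have := ht; rewrite len_none => ht'.
by rewrite subdiv_point_right ?addrK //; lra.
Qed.

Section Function.
Variable f : mpoint H -> R.

Let ef_other e (t : R) : e != e0 -> 0 <= t <= len e ->
  edge_fun (f \o phi) e t = edge_fun f (Some e) t.
Proof. by move=> ne ht; rewrite /edge_fun /= subdiv_point_other. Qed.

Let ef_left (t : R) : 0 <= t <= t0 ->
  edge_fun (f \o phi) e0 t = edge_fun f (Some e0) t.
Proof. by move=> ht; rewrite /edge_fun /= subdiv_point_left. Qed.

Let ef_right (t : R) : t0 <= t <= len e0 ->
  edge_fun (f \o phi) e0 t = edge_fun f None (t - t0).
Proof. by move=> ht; rewrite /edge_fun /= subdiv_point_right. Qed.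

Lemma subdiv_rational : rational_function f <-> rational_function (f \o phi).
Proof.
have /andP[t00 t0l] := ht0; split=> rf e.
  have [->|ne] := eqVneq e e0; last first.
    have := rf (Some e); rewrite -[pl_integer_slopes _ _]/(pl_on 0 _ _) len_some.
    by rewrite (negPf ne); apply: pl_on_ext => t; apply: ef_other.
  apply: (@pl_on_cat _ 0 t0); [lra|lra| |].
    have := rf (Some e0); rewrite -[pl_integer_slopes _ _]/(pl_on 0 _ _) len_some.
    by rewrite eqxx; apply: pl_on_ext => t; apply: ef_left.
  rewrite -[len e0](subrK t0) -[X in pl_on X]add0r.
  apply: pl_on_shift (rf None) => t; rewrite len_none => ht.
  by rewrite -/(edge_fun (f \o phi) e0 (t + t0)) ef_right ?addrK //; lra.
case: e => [e|].
  rewrite -[pl_integer_slopes _ _]/(pl_on 0 _ _) len_some.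
  have [->|ne] := eqVneq e e0; last first.
    by apply: pl_on_ext (rf e) => t ht; apply/esym/ef_other.
  apply: pl_on_ext (pl_on_sub (lexx 0) (ltW t0l) (rf e0)) => t ht.
  exact/esym/ef_left.
rewrite -[pl_integer_slopes _ _]/(pl_on 0 _ _) len_none -[X in pl_on X](subrr t0).
apply: pl_on_shift (pl_on_sub (ltW t00) (lexx _) (rf e0)) => t ht.
by apply/esym; apply: ef_right.
Qed.

Lemma subdiv_tail_sum (A : nmodType) (F : edge H -> A) (v : vertex G) :
  \sum_(e : edge H | tail e == (Some v : vertex H)) F e
  = \sum_(e : edge G | tail e == v) F (Some e).
Proof. by rewrite big_option /= add0r. Qed.

Lemma subdiv_head_sum (A : nmodType) (F : edge H -> A) (v : vertex G) :
  \sum_(e : edge H | head e == (Some v : vertex H)) F e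
  = \sum_(e : edge G | head e == v) if e == e0 then F None else F (Some e).
Proof.
rewrite big_option /= (inj_eq (@Some_inj _)) big_mkcond [RHS]big_mkcond /=.
rewrite (bigD1 e0) //= eqxx /= add0r [RHS](bigD1 e0) //= eqxx.
by congr (_ + _); apply: eq_bigr => e ne; rewrite (negPf ne).
Qed.

Lemma subdiv_tail_sum_new (A : nmodType) (F : edge H -> A) :
  \sum_(e : edge H | tail e == (None : vertex H)) F e = F None.
Proof. by rewrite big_option /= big_pred0 ?addr0. Qed.

Lemma subdiv_head_sum_new (A : nmodType) (F : edge H -> A) :
  \sum_(e : edge H | head e == (None : vertex H)) F e = F (Some e0).
Proof.
rewrite big_option /= add0r (big_pred1 e0) // => e.
by rewrite /=; case: (eqVneq e e0).
Qed.

Lemma subdiv_ord p : ord_at (f \o phi) p = ord_at f (phi p).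
Proof.
have /andP[t00 t0l] := ht0; elim/mpoint_ind: p => [v|e t ht].
  rewrite /= subdiv_tail_sum subdiv_head_sum.
  congr (_ + _); apply: eq_bigr => e _.
    pose d := Num.min t0 (len e); have d0 : 0 < d by rewrite lt_min t00 len_gt0.
    apply: (slope_up_germ d0) => h; rewrite !add0r le_min => /and3P[h0 h1 h2].
    have [ee|ne] := eqVneq e e0; last by apply: ef_other; rewrite // h0.
    by rewrite ee; apply: ef_left; rewrite h0.
  have [->|ne] := eqVneq e e0.
    have d0 : 0 < len e0 - t0 by rewrite subr_gt0.
    apply: (slope_down_germ d0) => h hh.
    by rewrite [LHS]ef_right ?len_none ?[len e0 - h - t0]addrAC //; lra.
  rewrite /= (negPf ne); apply: (slope_down_germ (len_gt0 e)) => h hh.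
  by apply: ef_other => //; lra.
have /andP[h0 hl] := ht; rewrite ord_at_pt //.
have [ee|ne] := eqVneq e e0; last first.
  rewrite subdiv_point_other ?(ltW h0) ?(ltW hl) // ord_at_pt ?len_some ?(negPf ne) //.
  rewrite /kink; congr (_ + _).
    apply: (@slope_up_germ _ _ _ _ _ (len e - t)); first by rewrite subr_gt0.
    by move=> h hh; apply: ef_other => //; lra.
  by apply: (slope_down_germ h0) => h hh; apply: ef_other => //; lra.
subst e; have [lt|gt|->] := ltgtP t t0.
- rewrite subdiv_point_left ?(ltW h0) ?(ltW lt) // ord_at_pt ?len_some ?eqxx ?h0 //.
  rewrite /kink; congr (_ + _).
    apply: (@slope_up_germ _ _ _ _ _ (t0 - t)); first by rewrite subr_gt0.
    by move=> h hh; apply: ef_left => //; lra.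
  by apply: (slope_down_germ h0) => h hh; apply: ef_left => //; lra.
- rewrite subdiv_point_right ?(ltW gt) ?(ltW hl) // ord_at_pt ?len_none; last by lra.
  rewrite /kink; congr (_ + _).
    apply: (@slope_up_germ _ _ _ _ _ (len e0 - t)); first by rewrite subr_gt0.
    by move=> h hh; rewrite ef_right ?[t - t0 + h]addrAC //; lra.
  apply: (@slope_down_germ _ _ _ _ _ (t - t0)); first by rewrite subr_gt0.
  by move=> h hh; rewrite ef_right ?[t - t0 - h]addrAC //; lra.
rewrite subdiv_point_right ?lexx ?ltW // subrr pt_tail [ord_at f _]/=.
rewrite subdiv_tail_sum_new subdiv_head_sum_new /= eqxx /kink; congr (_ + _).
  apply: (@slope_up_germ _ _ _ _ _ (len e0 - t0)); first by rewrite subr_gt0.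
  move=> h hh; rewrite ef_right; last by lra.
  by rewrite addrAC subrr.
by apply: (slope_down_germ t00) => h hh; apply: ef_left => //; lra.
Qed.

End Function.

Lemma val_sums (M : multigraph) (v : vertex M) :
  val v = (\sum_(e | tail e == v) 1 + \sum_(e | head e == v) 1)%N.
Proof. by rewrite /val !sum1_card. Qed.

Lemma subdiv_canonical p : coeff (phi p) (mcanonical H) = coeff p (mcanonical G).
Proof.
have KH : mcanonical H = metric_vertex_divisor (fun v => (val v)%:Z - 2) by [].
have KG : mcanonical G = metric_vertex_divisor (fun v => (val v)%:Z - 2) by [].
have /andP[t00 t0l] := ht0; elim/mpoint_ind: p => [v|e t ht].
  rewrite /= KH KG !coeff_metric_vertex_divisor !val_sums.
  rewrite (@subdiv_tail_sum nat (fun=> 1%N)) (@subdiv_head_sum nat (fun=> 1%N)).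
  by congr (Posz (_ + _) - _); apply: eq_bigr => e _; rewrite if_same.
rewrite KG metric_vertex_divisor_supported // KH.
have /andP[h0 hl] := ht; have [ee|ne] := eqVneq e e0; last first.
  rewrite subdiv_point_other ?(ltW h0) ?(ltW hl) //.
  by rewrite metric_vertex_divisor_supported // len_some (negPf ne).
subst e; have [lt|gt|->] := ltgtP t t0.
- rewrite subdiv_point_left ?(ltW h0) ?(ltW lt) //.
  by rewrite metric_vertex_divisor_supported // len_some eqxx h0.
- rewrite subdiv_point_right ?(ltW gt) ?(ltW hl) //.
  by rewrite metric_vertex_divisor_supported // len_none; lra.
rewrite subdiv_point_right ?lexx ?ltW // subrr pt_tail coeff_metric_vertex_divisor.
by rewrite val_sums (@subdiv_tail_sum_new nat (fun=> 1%N))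
           (@subdiv_head_sum_new nat (fun=> 1%N)).
Qed.

Lemma subdiv_refinement : model_refinement phi.
Proof.
split.
- by exists unsubdivide; [apply: subdiv_pointK | apply: unsubdivideK].
- exact: subdiv_rational.
- exact: subdiv_ord.
- by move=> v; exists (Some v).
- exact: subdiv_canonical.
Qed.

End Subdivide.

Lemma to_model_refinement (R : realType) (G : mgraph R) (p : mpoint G) :
  model_refinement (to_model_at p).
Proof. by case: p => [v|[[e t] ht]]; [apply: refinement_id | apply: subdiv_refinement]. Qed.

Lemma to_model_at_vertex (R : realType) (G : mgraph R) (p : mpoint G) :
  to_model_at p p = inl (vertex_at p).
Proof.
case: p => [v|[[e t] ht]] //; have /andP[t0 tl] := ht.
transitivity (subdiv_point ht (pt e t)); first by rewrite pt_interior.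
by rewrite subdiv_point_right ?lexx ?ltW // subrr pt_tail.
Qed.

Lemma refine_points (R : realType) (G : mgraph R) (s : seq (mpoint G)) :
  exists (H : mgraph R) (phi : mpoint G -> mpoint H), model_refinement phi /\
    forall p, p \in s -> exists v, phi p = inl v.
Proof.
elim: s => [|p s [H [phi [rphi hs]]]]; first by exists G, id; split; [apply: refinement_id |].
exists (model_at (phi p)), (to_model_at (phi p) \o phi).
have rr := to_model_refinement (phi p); split; first exact: refinement_comp.
move=> x; rewrite inE => /orP[/eqP->|/hs[v e]] /=.
  by exists (vertex_at (phi p)); rewrite to_model_at_vertex.
by case: rr => _ _ _ hv _; rewrite e; apply: hv.
Qed.

(** Each subdivision at the midpoint of a loop removes one loop. *)
Lemma refine_loopless (R : realType) (G : mgraph R) :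
  exists (H : mgraph R) (phi : mpoint G -> mpoint H), model_refinement phi /\
    forall e : edge H, tail e != head e.
Proof.
have [n] := ubnP #|[pred e : edge G | tail e == head e]|.
elim: n G => // n IH G lt.
have [/existsP[e he]|/existsPn none] := boolP [exists e : edge G, tail e == head e];
  last by exists G, id; split=> //; apply: refinement_id.
have l0 := len_gt0 e; have ht : 0 < len e / 2 < len e by lra.
have [|H [phi [rphi hH]]] := IH (subdiv ht); last first.
  by exists H, (phi \o subdiv_point ht); split=> //;
    apply: refinement_comp rphi; apply: subdiv_refinement.
rewrite -ltnS; apply: leq_trans lt; rewrite ltnS.
pose A := [pred e : edge G | tail e == head e].
have e_in : e \in A by [].
rewrite (cardD1 e) e_in add1n ltnS.
have someI : injective (@Some (edge G)) by move=> x y [].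
rewrite -[X in (_ <= X)%N](fintype.card_image someI).
apply/subset_leq_card/fintype.subsetP => -[e'|]; rewrite !inE //= => h.
have ne : e' != e by apply: contraTneq h => ->; rewrite eqxx.
apply: fintype.image_f; rewrite !inE ne /=.
by move: h; rewrite (negPf ne) (inj_eq (@Some_inj _)).
Qed.
(** * Riemann-Roch for metric graphs *)

Section DivisorIso.
Variables (k : graph_kind) (G H : graph k) (i : points G -> points H).
Implicit Types D : divisor G.

Definition divisor_iso : Prop :=
  [/\ bijective i, forall D, principal D <-> principal (push i D) &
      push i (canonical G) = canonical H].

Hypothesis isoi : divisor_iso.

Lemma push_surj (D' : divisor H) : exists2 D : divisor G, push i D = D' &
  effective D' -> effective D.
Proof.
have [[j ij ji] _ _] := isoi; exists (push j D').
  by rewrite push_comp push_id // => q /=; rewrite ji.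
exact: push_effective.
Qed.

Lemma equiv_effective_iso D : equiv_effective D <-> equiv_effective (push i D).
Proof.
have [_ pr _] := isoi; split=> [[E effE /pr h]|[E' effE' h]].
  by exists (push i E); [apply: push_effective | rewrite /lin_equiv -pushB].
have [E eE /(_ effE') effE] := push_surj E'; exists E => //.
by apply/pr; rewrite pushB eE.
Qed.

End DivisorIso.

Lemma residual_witness_equiv (k : graph_kind) (G : graph k) (g1 : int)
    (D D' : divisor G) : principal_group G ->
  principal (D' - D) -> residual_witness g1 D' -> residual_witness g1 D.
Proof.
move=> pg DD' [mu [dmu nmu emu]]; exists mu; split=> //.
apply: (equiv_effective_trans pg) emu.
by rewrite (_ : _ - _ = D' - D) //; apply/eqP/freeg_eqP => z;
  rewrite !(coeffD, coeffN); ring.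
Qed.

Lemma residual_witness_iso (k : graph_kind) (G H : graph k) (g1 : int)
    (i : points H -> points G) (D : divisor H) :
  divisor_iso i -> residual_witness g1 (push i D) -> residual_witness g1 D.
Proof.
move=> isoi [mu' [dmu nmu emu]]; have [mu emu' _] := push_surj isoi mu'.
exists mu; split; first by rewrite -(deg_push i) emu'.
  by rewrite (equiv_effective_iso isoi) emu'.
by rewrite (equiv_effective_iso isoi) !pushB emu'; case: isoi => _ _ ->.
Qed.

Section MetricRiemannRoch.
Variable R : realType.
Implicit Types G H : mgraph R.
Local Notation mdivisor G := (@divisor (Metric R) G).

Lemma refinement_divisor_iso G H (phi : mpoint G -> mpoint H) :
  model_refinement phi -> @divisor_iso (Metric R) G H phi.
Proof.
case=> [[psi K1 K2] rat ordE vert can]; have inj := can_inj K1.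
have coeff_phi (D : mdivisor G) (p : mpoint G) :
    coeff (phi p) (@push (Metric R) G H phi D) = coeff p D.
  exact: (@coeff_push_inj (Metric R)).
split; first by exists psi.
- move=> D; split=> [[f rf hf]|[f rf hf]].
    have ff : (f \o psi) \o phi = f by apply/funext => x /=; rewrite K1.
    exists (f \o psi); first by apply/rat; rewrite ff.
    by move=> q; rewrite -[q]K2 coeff_phi hf -ordE ff.
  exists (f \o phi); first exact/rat.
  by move=> p; rewrite ordE -hf coeff_phi.
apply/eqP/freeg_eqP => q; rewrite -[q]K2 coeff_phi; exact/esym/can.
Qed.

Lemma refinement_vertex_supported G H (phi : mpoint G -> mpoint H) (D : mdivisor G) :
  model_refinement phi ->
  (forall p : mpoint G, p \in dom D -> exists v, phi p = inl v) ->
  vertex_supported (@push (Metric R) G H phi D).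
Proof.
case=> [[psi K1 K2] _ _ _ _] h e t ht; rewrite -[pt e t]K2.
rewrite (@coeff_push_inj (Metric R)); last exact: can_inj K1.
apply/eqP/negPn; rewrite -mem_dom; apply/negP => /h[v].
by rewrite K2; apply: pt_neq_vertex.
Qed.

(** The degree of a principal divisor is computed in a model that has all its
    points as vertices. *)
Lemma metric_principal_group G : principal_group (k := Metric R) G.
Proof.
split=> [|D E [f rf hf] [g rg hg]|D [f rf hf]].
- exists (fun=> 0); first exact: rational_cst.
  by move=> p; rewrite ord_at_cst coeff0.
- exists (fun p => f p - g p); first exact: rationalB.
  by move=> p; rewrite coeffB hf hg ord_atB.
have [H [phi [rphi hphi]]] := refine_points (dom D).
have isoi := refinement_divisor_iso rphi; have [[psi K1 K2] pr _] := isoi.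
have /pr[f' rf' hf'] : principal (k := Metric R) D by exists f.
rewrite -(@deg_push (Metric R) G H phi).
have supp := refinement_vertex_supported rphi hphi.
rewrite (deg_vertex_supported supp); under eq_bigr => v _ do rewrite hf'.
by apply: sum_ord_straight => // e t ht; rewrite -hf' supp.
Qed.

(** Reducedness in terms of functions instead of firing sets, so that it
    passes from one model to another. *)
Definition metric_reduced G (q : vertex G) (D : mdivisor G) : Prop :=
  forall g : mpoint G -> R, rational_function g -> g (inl q) = 0 ->
    (forall p : mpoint G, p != inl q -> 0 <= coeff p D + ord_at g p) ->
    forall p, g p <= 0.

(** A function that improves on the reduced divisor adds up with the maximal
    solution to another rooted solution; [chord_extension_max] then bounds it at
    all points, not only at the vertices of this model. *)
Lemma metric_reduced_exists G (q : vertex G) (D : mdivisor G) :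
  vertex_supported D -> exists D' : mdivisor G,
    [/\ mprincipal (D' - D), forall p : mpoint G, p != inl q -> 0 <= coeff p D' &
        metric_reduced q D'].
Proof.
move=> suppD; have [F [Fq hF] maxF] := max_rooted_solution
  (@len_gt0 R G) (@mgraph_connected R G) (fun v => coeff (inl v : mpoint G) D) q.
pose f := chord_extension F.
have rf : rational_function f := chord_extension_rational F.
have cf : convex_on_edges f := chord_extension_convex F.
have [P hP] := principal_divisor_exists rf; exists (D + P); split.
- by exists f => // p; rewrite addrC addKr hP.
- move=> p; elim/mpoint_ind: p => [v vq|e t ht _]; rewrite coeffD hP.
    by apply: le_trans (hF v vq) _; rewrite lerD2l; apply: chord_extension_ord.
  by rewrite suppD // add0r; apply: cf.
move=> g rg gq hg p.
have rfg := rationalD rf rg.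
have cfg : convex_on_edges (fun x => f x + g x).
  move=> e t ht; rewrite ord_atD //; have := hg (pt e t).
  rewrite coeffD hP suppD // add0r; apply; exact/eqP/pt_neq_vertex.
suff : f p + g p <= f p by rewrite gerDl.
apply: (chord_extension_max rfg cfg) => v.
apply: (maxF (fun w => f (inl w) + g (inl w))); split.
  by rewrite gq addr0.
move=> w wq; apply: le_trans (hg (inl w) _) _; first by [].
rewrite coeffD hP -addrA lerD2l -ord_atD //.
exact: ord_at_le_floor.
Qed.

(** Firing a set of vertices by at most the length of the shortest edge is a
    function to which reducedness applies, so no set away from [q] can fire. *)
Lemma metric_burning H (q : vertex H) (D : mdivisor H) :
  (forall e : edge H, tail e != head e) -> vertex_supported D ->
  (forall p : mpoint H, p != inl q -> 0 <= coeff p D) ->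
  coeff (inl q : mpoint H) D < 0 -> metric_reduced q D ->
  @residual_witness (Metric R) H (#|edge H|%:Z - #|vertex H|%:Z) D.
Proof.
move=> loopless suppD Dge Dq red; have l0 := @len_gt0 R H.
pose c (v : vertex H) : int := coeff (inl v : mpoint H) D.
have [eps eps0 eps_l] : exists2 eps : R, 0 < eps & forall e : edge H, eps <= len e.
  by apply: small_common => e; exists (len e) => // x /andP[].
have burn (A : {set vertex H}) : q \notin A -> A != finset.set0 ->
    exists2 v, v \in A & c v < out_darts A v.
  move=> qA A0; apply: contrapT => stuck.
  have hA v : v \in A -> out_darts A v <= c v.
    by move=> vA; rewrite leNgt; apply/negP => lt; apply: stuck; exists v.
  pose F (x : vertex H) : R := 0 + eps * (x \in A)%:R.
  have /set0Pn[v vA] := A0.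
  suff : chord_extension F (inl v) <= 0.
    by rewrite /= /F vA mulr1 add0r leNgt eps0.
  apply: red.
  - exact: chord_extension_rational.
  - by rewrite /= /F (negPf qA) mulr0 addr0.
  move=> p; elim/mpoint_ind: p => [w wq|e t ht _]; last first.
    by rewrite suppD // add0r; apply: chord_extension_convex.
  have := floor_laplacian_fire l0 (fun=> 0) A w (ltW eps0) eps_l.
  rewrite -/F [X in X - _]big1 => [|h _]; last first.
    by rewrite /floor_slope subrr mul0r floor0.
  have := chord_extension_ord F w; have := Dge _ wq; have := hA w; rewrite -/(c w).
  case: (w \in A) => /= [/(_ isT)|_]; lia.
have [ord ord_inj ord_D] := burning_order burn.
exists (metric_vertex_divisor (fun v => later_darts ord v - 1)); split.
- rewrite deg_vertex_supported; last exact: metric_vertex_divisor_supported.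
  under eq_bigr => v _ do rewrite coeff_metric_vertex_divisor.
  by rewrite sumrB sum_later // sum_const_int mul1r.
- move/metric_equiv_effectiveP=> [f rf hf].
  have cf : convex_on_edges f.
    move=> e t ht; have := hf (pt e t).
    by rewrite metric_vertex_divisor_supported // add0r.
  have [v] := order_divisor_noneffective ord (fun w => f (inl w)) q l0.
  have := hf (inl v); rewrite coeff_metric_vertex_divisor.
  have := ord_at_le_floor v rf cf; lia.
apply: (effective_equiv (metric_principal_group H)) => p.
have -> : canonical (k := Metric R) H = metric_vertex_divisor (fun v => (val v)%:Z - 2).
  by [].
rewrite !coeffB; elim/mpoint_ind: p => [v|e t ht]; last first.
  by rewrite !metric_vertex_divisor_supported // suppD.
rewrite !coeff_metric_vertex_divisor -/(c v).
have := later_earlier ord_inj loopless v.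
suff : c v < earlier_darts ord v by lia.
have [->|] := eqVneq v q; last exact: ord_D.
by apply: lt_le_trans Dq _; apply: sumr_ge0.
Qed.

(** Three models occur: one where D has its support on the vertices, one where
    the reduced divisor does, and a loopless one to carry the burning order. *)
Lemma metric_riemann_roch_witness G (q0 : mpoint G) :
  riemann_roch_witness (k := Metric R) G.
Proof.
have q0v : vertex G by case: q0 => [v|[[e t] _]]; [exact: v | exact: tail e].
exists (#|edge G|%:Z - #|vertex G|%:Z); first exact: deg_mcanonical.
move=> D nD; have [G1 [phi1 [r1 h1]]] := refine_points (dom D).
have iso1 := refinement_divisor_iso r1.
have [_ _ _ /(_ q0v)[q1 _] _] := r1.
have supp1 := refinement_vertex_supported r1 h1.
apply: (residual_witness_iso iso1).
have [D2 [D12 D2ge D2red]] := metric_reduced_exists q1 supp1.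
apply: (residual_witness_equiv (metric_principal_group G1) D12).
have D2q : coeff (inl q1 : mpoint G1) D2 < 0.
  rewrite ltNge; apply/negP => D2q; apply: nD.
  apply/(equiv_effective_iso iso1); exists D2.
    by move=> p; have [->|] := eqVneq p (inl q1); [apply: D2q | apply: D2ge].
  by rewrite /lin_equiv -opprB; apply: (principalN (metric_principal_group G1)).
have [G2 [phi2 [r2 h2]]] := refine_points (dom D2).
have [H [phi3 [r3 loopless]]] := refine_loopless G2.
pose phi := phi3 \o phi2; have r := refinement_comp r2 r3.
have iso := refinement_divisor_iso r; apply: (residual_witness_iso iso).
have [[psi K1 K2] rat ordE vert can] := r; have inj := can_inj K1.
have [q hq] := vert q1.
have gE : #|edge H|%:Z - #|vertex H|%:Z = #|edge G|%:Z - #|vertex G|%:Z.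
  have := deg_mcanonical H; have := deg_mcanonical G.
  have [_ _ e2] := iso; have [_ _ e1] := iso1.
  rewrite -[mcanonical H]e2 (@deg_push (Metric R)) -e1 (@deg_push (Metric R)) => ->.
  lia.
rewrite -gE; apply: (metric_burning (q := q)) => //.
- apply: (refinement_vertex_supported r) => p /h2[v e].
  by case: r3 => _ _ _ /(_ v)[w hw] _; exists w; rewrite /= e hw.
- move=> p; rewrite -[p]K2 -hq (inj_eq inj) (@coeff_push_inj (Metric R)) //.
  exact: D2ge.
- by rewrite -hq (@coeff_push_inj (Metric R)).
move=> g /rat rg gq hg p; rewrite -[p]K2.
apply: (D2red (g \o (phi3 \o phi2))) => //; first by move: gq; rewrite -hq.
move=> x xq; rewrite ordE; have := hg ((phi3 \o phi2) x).
by rewrite -hq (inj_eq inj) (@coeff_push_inj (Metric R)) //; apply.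
Qed.

End MetricRiemannRoch.
(** * Divisors and functions on a vertex gluing *)

Section Wedge.
Variables (k : graph_kind) (G1 G2 G : graph k).
Variables (i1 : points G1 -> points G) (i2 : points G2 -> points G).
Variables (w1 : points G1) (v2 : points G2).

Definition wedge_maps : Prop :=
  [/\ injective i1, injective i2,
      forall x y, i1 x = i2 y <-> x = w1 /\ y = v2 &
      forall p, (exists x, p = i1 x) \/ (exists y, p = i2 y)].

Definition wedge_principal : Prop :=
  forall (D1 : divisor G1) (D2 : divisor G2),
    principal (push i1 D1 + push i2 D2) <->
    exists c : int, principal (D1 - pdiv_mul c w1) /\ principal (D2 + pdiv_mul c v2).

Hypothesis wm : wedge_maps.

Lemma wedge_point : i1 w1 = i2 v2.
Proof. by case: wm => _ _ h _; apply/h. Qed.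

Lemma coeff_wedge_l (D1 : divisor G1) (D2 : divisor G2) x :
  coeff (i1 x) (push i1 D1 + push i2 D2)
  = coeff x D1 + (if x == w1 then coeff v2 D2 else 0).
Proof.
have [inj1 inj2 meet _] := wm; rewrite coeffD coeff_push_inj //; congr (_ + _).
case: eqP => [->|ne]; first by rewrite wedge_point coeff_push_inj.
by apply: coeff_push_out => y; apply/eqP => /esym/meet[].
Qed.

Lemma coeff_wedge_r (D1 : divisor G1) (D2 : divisor G2) y :
  coeff (i2 y) (push i1 D1 + push i2 D2)
  = (if y == v2 then coeff w1 D1 else 0) + coeff y D2.
Proof.
have [inj1 inj2 meet _] := wm; rewrite coeffD coeff_push_inj //; congr (_ + _).
case: eqP => [->|ne]; first by rewrite -wedge_point coeff_push_inj.
by apply: coeff_push_out => x; apply/eqP => /meet[].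
Qed.

Lemma wedge_eqP (D E : divisor G) :
  (forall x, coeff (i1 x) D = coeff (i1 x) E) ->
  (forall y, coeff (i2 y) D = coeff (i2 y) E) -> D = E.
Proof.
have [_ _ _ surj] := wm => h1 h2; apply/eqP/freeg_eqP => p.
by have [[x ->]|[y ->]] := surj p.
Qed.

(** At the points other than the gluing point nothing can cancel. *)
Lemma wedge_kernel (D1 : divisor G1) (D2 : divisor G2) :
  push i1 D1 + push i2 D2 = 0 ->
  exists c, D1 = pdiv_mul c w1 /\ D2 = - pdiv_mul c v2.
Proof.
move=> e; exists (coeff w1 D1); split; apply/eqP/freeg_eqP => z; last first.
  have := coeff_wedge_r D1 D2 z; rewrite e coeff0 coeffN coeffU eq_sym.
  by case: eqP => _; rewrite ?mulr1 ?mulr0; lia.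
have := coeff_wedge_l D1 D2 z; rewrite e coeff0 coeffU [w1 == z]eq_sym.
by case: eqP => [->|_]; rewrite ?mulr1 ?mulr0 //; lia.
Qed.

Section Functions.
Variables (X : zmodType).
Variables (rat : (points G -> X) -> Prop) (ord : (points G -> X) -> points G -> int).
Variables (rat1 : (points G1 -> X) -> Prop)
  (ord1 : (points G1 -> X) -> points G1 -> int).
Variables (rat2 : (points G2 -> X) -> Prop)
  (ord2 : (points G2 -> X) -> points G2 -> int).

(** What integer functions on the vertices of a finite graph and rational
    functions on a metric graph have in common. *)
Definition principal_by (H : graph k) (ra : (points H -> X) -> Prop)
    (o : (points H -> X) -> points H -> int) : Prop :=
  [/\ forall D : divisor H, principal D <->
        exists2 f, ra f & forall p, coeff p D = o f p,
      forall f, ra f -> exists D : divisor H, forall p, coeff p D = o f p &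
      forall f c, ra f -> ra (fun p => f p + c) /\
        forall p, o (fun p => f p + c) p = o f p].

Hypotheses (pb : principal_by rat ord) (pb1 : principal_by rat1 ord1)
  (pb2 : principal_by rat2 ord2).
Hypothesis rat_wedge : forall f, rat f <-> rat1 (f \o i1) /\ rat2 (f \o i2).
Hypothesis ord_l : forall f x, ord f (i1 x)
  = ord1 (f \o i1) x + (if x == w1 then ord2 (f \o i2) v2 else 0).
Hypothesis ord_r : forall f y, ord f (i2 y)
  = (if y == v2 then ord1 (f \o i1) w1 else 0) + ord2 (f \o i2) y.

(** The value at a point is prescribed by each of its preimages; they agree
    at the gluing point. *)
Lemma wedge_function (f1 : points G1 -> X) (f2 : points G2 -> X) :
  f1 w1 = f2 v2 -> exists f, f \o i1 = f1 /\ f \o i2 = f2.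
Proof.
have [inj1 inj2 meet surj] := wm => e.
have /choice[f hf] : forall p, exists a, (forall x, p = i1 x -> a = f1 x) /\
    (forall y, p = i2 y -> a = f2 y).
  move=> p; have [[x ->]|[y ->]] := surj p.
    exists (f1 x); split=> [x' /inj1 -> //|y /meet[-> ->]]; exact: e.
  by exists (f2 y); split=> [x /esym/meet[-> ->]|y' /inj2 ->].
exists f; split; apply/funext => z /=; first exact: (hf (i1 z)).1.
exact: (hf (i2 z)).2.
Qed.

(** A constant added to one of two functions makes them agree at the gluing
    point.  Conversely the number [c] records how the chips of the common point
    are shared between the two sides. *)
Lemma wedge_principal_by : wedge_principal.
Proof.
have [inj1 inj2 meet surj] := wm.
have [pr _ _] := pb; have [pr1 ex1 _] := pb1; have [pr2 ex2 sh2] := pb2.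
move=> D1 D2; split=> [/pr[f /rat_wedge[r1 r2] hf]|].
  have [P1 hP1] := ex1 _ r1; have [P2 hP2] := ex2 _ r2.
  have e : push i1 D1 + push i2 D2 = push i1 P1 + push i2 P2.
    apply: wedge_eqP => z; first by rewrite hf ord_l coeff_wedge_l hP1 hP2.
    by rewrite hf ord_r coeff_wedge_r hP1 hP2.
  have [|c [e1 e2]] := @wedge_kernel (D1 - P1) (D2 - P2).
    by rewrite !pushB addrACA -opprD e subrr.
  exists c; rewrite -e1 -[pdiv_mul c v2]opprK -e2 !subKr; split.
    by apply/pr1; exists (f \o i1).
  by apply/pr2; exists (f \o i2).
case=> c [/pr1[f1 r1 hf1] /pr2[f2 r2 hf2]].
have [r2' o2'] := sh2 f2 (f1 w1 - f2 v2) r2.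
have [f [e1 e2]] := @wedge_function f1 (fun p => f2 p + (f1 w1 - f2 v2))
  (esym (subrKC _ _)).
apply/pr; exists f; first by apply/rat_wedge; rewrite e1 e2.
have -> : push i1 D1 + push i2 D2
    = push i1 (D1 - pdiv_mul c w1) + push i2 (D2 + pdiv_mul c v2).
  by rewrite pushB pushD !pushU wedge_point addrACA addNr addr0.
move=> p; have [[x ->]|[y ->]] := surj p.
  by rewrite coeff_wedge_l ord_l e1 e2 !o2' hf1 hf2.
by rewrite coeff_wedge_r ord_r e1 e2 !o2' hf1 hf2.
Qed.

End Functions.
End Wedge.

Section WedgeIso.
Variables (k : graph_kind) (G1 G2 H1 H2 G : graph k).
Variables (j1 : points H1 -> points G) (j2 : points H2 -> points G).
Variables (phi1 : points G1 -> points H1) (phi2 : points G2 -> points H2).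
Variables (w1 : points G1) (v2 : points G2).
Hypotheses (iso1 : divisor_iso phi1) (iso2 : divisor_iso phi2).

Lemma wedge_maps_comp : wedge_maps j1 j2 (phi1 w1) (phi2 v2) ->
  wedge_maps (j1 \o phi1) (j2 \o phi2) w1 v2.
Proof.
have [b1 _ _] := iso1; have [b2 _ _] := iso2.
move=> [inj1 inj2 meet surj]; split.
- exact: inj_comp inj1 (bij_inj b1).
- exact: inj_comp inj2 (bij_inj b2).
- move=> x y; split=> [/meet[/(bij_inj b1)-> /(bij_inj b2)->] //|[-> ->]].
  exact/meet.
have [psi1 _ K1] := b1; have [psi2 _ K2] := b2.
move=> p; case: (surj p) => [[x ->]|[y ->]]; [left|right].
  by exists (psi1 x); rewrite /= K1.
by exists (psi2 y); rewrite /= K2.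
Qed.

Lemma wedge_principal_comp : wedge_principal j1 j2 (phi1 w1) (phi2 v2) ->
  wedge_principal (j1 \o phi1) (j2 \o phi2) w1 v2.
Proof.
have [_ pr1 _] := iso1; have [_ pr2 _] := iso2.
move=> wp D1 D2; rewrite -(push_comp phi1) -(push_comp phi2) wp.
split=> -[c [h1 h2]]; exists c; split.
- by apply/pr1; rewrite pushB pushU.
- by apply/pr2; rewrite pushD pushU.
- by move/pr1: h1; rewrite pushB pushU.
- by move/pr2: h2; rewrite pushD pushU.
Qed.

End WedgeIso.

Section GlueSums.
Variables (M1 M2 : multigraph) (w1 : vertex M1) (v2 : vertex M2) (A : nmodType).
Local Notation M := (mg_glue w1 v2).
Local Notation glr := (glue_vertex_r w1 v2).

Lemma glue_vertex_r_point : glr v2 = inl w1.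
Proof. by rewrite /glue_vertex_r insubF // eqxx. Qed.

Lemma glue_vertex_r_val (y : {x : vertex M2 | x != v2}) : glr (\val y) = inr y.
Proof. by rewrite /glue_vertex_r valK. Qed.

Lemma glue_vertex_r_inl x y : inl x = glr y <-> x = w1 /\ y = v2.
Proof.
split=> [|[-> ->]]; last by rewrite glue_vertex_r_point.
by rewrite /glue_vertex_r; case: insubP => // /negPn/eqP -> [->].
Qed.

Section End.
Variables (t1 : edge M1 -> vertex M1) (t2 : edge M2 -> vertex M2).
Let t (e : edge M) : vertex M :=
  match e with inl e1 => inl (t1 e1) | inr e2 => glr (t2 e2) end.

Lemma glue_sum_l (F : edge M -> A) x : \sum_(e | t e == inl x) F e
  = \sum_(e | t1 e == x) F (inl e)
    + (if x == w1 then \sum_(e | t2 e == v2) F (inr e) else 0).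
Proof.
rewrite big_sumType /=; congr (_ + _); case: eqP => [->|ne].
  apply: eq_bigl => e; apply/eqP/eqP => [/esym/glue_vertex_r_inl[]//|->].
  exact: glue_vertex_r_point.
by apply: big_pred0 => e; apply/eqP => /esym/glue_vertex_r_inl[].
Qed.

Lemma glue_sum_r (F : edge M -> A) y : \sum_(e | t e == glr y) F e
  = (if y == v2 then \sum_(e | t1 e == w1) F (inl e) else 0)
    + \sum_(e | t2 e == y) F (inr e).
Proof.
rewrite big_sumType /=; congr (_ + _); last first.
  by apply: eq_bigl => e; rewrite (inj_eq (@glue_vertex_r_inj _ _ _ _)).
case: eqP => [->|ne]; first by rewrite glue_vertex_r_point.
by apply: big_pred0 => e; apply/eqP => /glue_vertex_r_inl[].
Qed.

End End.
End GlueSums.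

Lemma addr_if (A : nmodType) (b : bool) (x y : A) :
  (if b then x else 0) + (if b then y else 0) = if b then x + y else 0.
Proof. by case: b; rewrite ?addr0. Qed.

Section FiniteGlue.
Variables (G1 G2 : fgraph) (w1 : vertex G1) (v2 : vertex G2).
Local Notation G := (fglue w1 v2).

Lemma finite_wedge_maps : @wedge_maps Finite G1 G2 G
  (@glue_inl Finite G1 G2 w1 v2) (@glue_inr Finite G1 G2 w1 v2) w1 v2.
Proof.
split.
- by move=> x y [].
- exact: glue_vertex_r_inj.
- exact: glue_vertex_r_inl.
case=> [x|y]; first by left; exists x.
by right; exists (\val y); rewrite /= glue_vertex_r_val.
Qed.

Lemma finite_principal_by (H : fgraph) : @principal_by Finite int H
  (fun=> True) (fun f v => laplacian f v).
Proof.
split=> [D|f _|f c _].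
- by split=> [[f hf]|[f _ hf]]; exists f.
- exists (vertex_divisor (laplacian f)); exact: coeff_vertex_divisor.
split=> // p; rewrite !laplacian_darts; apply: eq_bigr => h _; ring.
Qed.

Lemma finite_wedge_principal : @wedge_principal Finite G1 G2 G
  (@glue_inl Finite G1 G2 w1 v2) (@glue_inr Finite G1 G2 w1 v2) w1 v2.
Proof.
apply: (@wedge_principal_by Finite G1 G2 G _ _ w1 v2 finite_wedge_maps int
  _ _ _ _ _ _ (finite_principal_by G) (finite_principal_by G1)
  (finite_principal_by G2)) => //.
- move=> f x; rewrite /laplacian.
  rewrite (glue_sum_l _ _ (fun e : edge G => f (head e) - f (inl x))).
  rewrite (glue_sum_l _ _ (fun e : edge G => f (tail e) - f (inl x))).
  rewrite addrACA addr_if /=; congr (_ + _); case: eqP => // ->.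
  by rewrite -glue_vertex_r_point.
- move=> f y; rewrite /laplacian.
  rewrite (glue_sum_r _ _ (fun e : edge G => f (head e) - f (glue_vertex_r w1 v2 y))).
  rewrite (glue_sum_r _ _ (fun e : edge G => f (tail e) - f (glue_vertex_r w1 v2 y))).
  rewrite addrACA addr_if /=; congr (_ + _); case: eqP => // ->.
  by rewrite glue_vertex_r_point.
Qed.

End FiniteGlue.

Section MetricGlue.
Variable R : realType.

Lemma metric_principal_by (H : mgraph R) : @principal_by (Metric R) R H
  (@rational_function R H) (@ord_at R H).
Proof.
split=> [D //|f rf|f c rf]; first exact: principal_divisor_exists rf.
have rc := @rational_cst R H c; split; first exact: rationalD.
by move=> p; rewrite ord_atD // ord_at_cst addr0.
Qed.

Section VertexGlue.
Variables (G1 G2 : mgraph R) (w1 : vertex G1) (v2 : vertex G2).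
Local Notation G := (mvglue w1 v2).
Local Notation i1 := (@mvglue_inl R G1 G2 w1 v2).
Local Notation i2 := (@mvglue_inr R G1 G2 w1 v2).

Lemma mvglue_inl_pt e (t : R) : 0 <= t <= len e -> i1 (pt e t) = @pt R G (inl e) t.
Proof.
move=> /andP[t0 tl]; have [->|n0] := eqVneq t 0; first by rewrite !pt_tail.
have [->|nl] := eqVneq t (len e).
  by rewrite pt_head -[len e]/(@len R G (inl e)) pt_head.
have ht : 0 < t < len e by rewrite !lt_neqAle eq_sym n0 t0 nl tl.
by rewrite pt_interior.
Qed.

Lemma mvglue_inr_pt e (t : R) : 0 <= t <= len e -> i2 (pt e t) = @pt R G (inr e) t.
Proof.
move=> /andP[t0 tl]; have [->|n0] := eqVneq t 0; first by rewrite !pt_tail.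
have [->|nl] := eqVneq t (len e).
  by rewrite pt_head -[len e]/(@len R G (inr e)) pt_head.
have ht : 0 < t < len e by rewrite !lt_neqAle eq_sym n0 t0 nl tl.
by rewrite pt_interior.
Qed.

Lemma pt_inj (H : mgraph R) (e e' : edge H) (t t' : R) :
  0 < t < len e -> 0 < t' < len e' -> pt e t = pt e' t' -> e = e' /\ t = t'.
Proof. by move=> ht ht'; rewrite !pt_interior => -[-> ->]. Qed.

Let itvW (a b t : R) : a < t < b -> a <= t <= b.
Proof. by move=> /andP[h1 h2]; rewrite !ltW. Qed.

Lemma metric_wedge_maps : @wedge_maps (Metric R) G1 G2 G i1 i2 (inl w1) (inl v2).
Proof.
split.
- move=> x y; elim/mpoint_ind: x => [x|e t ht]; elim/mpoint_ind: y => [y|e' t' ht'].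
  + by case=> ->.
  + by rewrite (mvglue_inl_pt (itvW ht')) => /esym/(@pt_neq_vertex R G (inl e') _ _ ht').
  + by rewrite (mvglue_inl_pt (itvW ht)) => /(@pt_neq_vertex R G (inl e) _ _ ht).
  rewrite !mvglue_inl_pt ?itvW // => /(@pt_inj G (inl e) (inl e') _ _ ht ht').
  by case=> -[->] ->.
- move=> x y; elim/mpoint_ind: x => [x|e t ht]; elim/mpoint_ind: y => [y|e' t' ht'].
  + by case=> /glue_vertex_r_inj ->.
  + by rewrite (mvglue_inr_pt (itvW ht')) => /esym/(@pt_neq_vertex R G (inr e') _ _ ht').
  + by rewrite (mvglue_inr_pt (itvW ht)) => /(@pt_neq_vertex R G (inr e) _ _ ht).
  rewrite !mvglue_inr_pt ?itvW // => /(@pt_inj G (inr e) (inr e') _ _ ht ht').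
  by case=> -[->] ->.
- move=> x y; split=> [|[-> ->]]; last by rewrite /= glue_vertex_r_point.
  elim/mpoint_ind: x => [x|e t ht]; elim/mpoint_ind: y => [y|e' t' ht'].
  + by case=> /glue_vertex_r_inl[-> ->].
  + by rewrite (mvglue_inr_pt (itvW ht')) => /esym/(@pt_neq_vertex R G (inr e') _ _ ht').
  + by rewrite (mvglue_inl_pt (itvW ht)) => /(@pt_neq_vertex R G (inl e) _ _ ht).
  rewrite mvglue_inl_pt ?mvglue_inr_pt ?itvW //.
  by move=> /(@pt_inj G (inl e) (inr e') _ _ ht ht')[].
move=> p; elim/mpoint_ind: p => [[x|y]|[e|e] t ht].
- by left; exists (inl x).
- by right; exists (inl (\val y)); rewrite /= glue_vertex_r_val.
- by left; exists (pt e t); rewrite mvglue_inl_pt // itvW.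
- by right; exists (pt e t); rewrite mvglue_inr_pt // itvW.
Qed.

Section Function.
Variable f : mpoint G -> R.

Let ef_l e (t : R) : 0 <= t <= len e -> edge_fun (f \o i1) e t = edge_fun f (inl e) t.
Proof. by move=> ht; rewrite /edge_fun /= mvglue_inl_pt. Qed.

Let ef_r e (t : R) : 0 <= t <= len e -> edge_fun (f \o i2) e t = edge_fun f (inr e) t.
Proof. by move=> ht; rewrite /edge_fun /= mvglue_inr_pt. Qed.

Lemma mvglue_rational : rational_function f <->
  rational_function (f \o i1) /\ rational_function (f \o i2).
Proof.
split=> [rf|[r1 r2]]; first split=> e.
- by apply: pl_on_ext (rf (inl e)) => t; apply: ef_l.
- by apply: pl_on_ext (rf (inr e)) => t; apply: ef_r.
case=> e.
- by apply: pl_on_ext (r1 e) => t ht; apply/esym/ef_l.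
- by apply: pl_on_ext (r2 e) => t ht; apply/esym/ef_r.
Qed.

Lemma mvglue_slope_l e (t : R) :
  (0 <= t < len e -> slope_up (edge_fun f (inl e)) t = slope_up (edge_fun (f \o i1) e) t)
  /\ (0 < t <= len e ->
      slope_down (edge_fun f (inl e)) t = slope_down (edge_fun (f \o i1) e) t).
Proof.
split=> ht.
  apply: (@slope_up_germ _ _ _ _ _ (len e - t)); first by lra.
  by move=> h hh; rewrite ef_l //; lra.
apply: (@slope_down_germ _ _ _ _ _ t); first by lra.
by move=> h hh; rewrite ef_l //; lra.
Qed.

Lemma mvglue_slope_r e (t : R) :
  (0 <= t < len e -> slope_up (edge_fun f (inr e)) t = slope_up (edge_fun (f \o i2) e) t)
  /\ (0 < t <= len e ->
      slope_down (edge_fun f (inr e)) t = slope_down (edge_fun (f \o i2) e) t).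
Proof.
split=> ht.
  apply: (@slope_up_germ _ _ _ _ _ (len e - t)); first by lra.
  by move=> h hh; rewrite ef_r //; lra.
apply: (@slope_down_germ _ _ _ _ _ t); first by lra.
by move=> h hh; rewrite ef_r //; lra.
Qed.

Let ord_vertex (H : mgraph R) (g : mpoint H -> R) v : ord_at g (inl v)
  = \sum_(e | tail e == v) slope_up (edge_fun g e) 0
    + \sum_(e | head e == v) slope_down (edge_fun g e) (len e).
Proof. by []. Qed.

Let sum_up_l v : \sum_(e : edge G1 | tail e == v) slope_up (edge_fun f (inl e)) 0
  = \sum_(e : edge G1 | tail e == v) slope_up (edge_fun (f \o i1) e) 0.
Proof. by apply: eq_bigr => e _; rewrite (mvglue_slope_l e 0).1 // lexx len_gt0. Qed.

Let sum_up_r v : \sum_(e : edge G2 | tail e == v) slope_up (edge_fun f (inr e)) 0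
  = \sum_(e : edge G2 | tail e == v) slope_up (edge_fun (f \o i2) e) 0.
Proof. by apply: eq_bigr => e _; rewrite (mvglue_slope_r e 0).1 // lexx len_gt0. Qed.

Let sum_down_l v :
  \sum_(e : edge G1 | head e == v) slope_down (edge_fun f (inl e)) (len e)
  = \sum_(e : edge G1 | head e == v) slope_down (edge_fun (f \o i1) e) (len e).
Proof. by apply: eq_bigr => e _; rewrite (mvglue_slope_l e _).2 // lexx len_gt0. Qed.

Let sum_down_r v :
  \sum_(e : edge G2 | head e == v) slope_down (edge_fun f (inr e)) (len e)
  = \sum_(e : edge G2 | head e == v) slope_down (edge_fun (f \o i2) e) (len e).
Proof. by apply: eq_bigr => e _; rewrite (mvglue_slope_r e _).2 // lexx len_gt0. Qed.

Lemma mvglue_ord_l x : ord_at f (i1 x)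
  = ord_at (f \o i1) x + (if x == inl w1 then ord_at (f \o i2) (inl v2) else 0).
Proof.
elim/mpoint_ind: x => [v|e t ht].
  rewrite !ord_vertex.
  rewrite (glue_sum_l _ _ (fun e : edge G => slope_up (edge_fun f e) 0)).
  rewrite (glue_sum_l _ _ (fun e : edge G => slope_down (edge_fun f e) (len e))).
  by rewrite addrACA addr_if sum_up_l sum_up_r sum_down_l sum_down_r.
have /andP[t0 tl] := ht; rewrite mvglue_inl_pt ?itvW // ord_at_pt // ord_at_pt //.
case: eqP => [/(pt_neq_vertex ht) //|_]; rewrite addr0 /kink.
by rewrite (mvglue_slope_l e t).1 ?(mvglue_slope_l e t).2 ?t0 ?tl ?ltW.
Qed.

Lemma mvglue_ord_r y : ord_at f (i2 y)
  = (if y == inl v2 then ord_at (f \o i1) (inl w1) else 0) + ord_at (f \o i2) y.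
Proof.
elim/mpoint_ind: y => [v|e t ht].
  rewrite !ord_vertex.
  rewrite (glue_sum_r _ _ (fun e : edge G => slope_up (edge_fun f e) 0)).
  rewrite (glue_sum_r _ _ (fun e : edge G => slope_down (edge_fun f e) (len e))).
  by rewrite addrACA addr_if sum_up_l sum_up_r sum_down_l sum_down_r.
have /andP[t0 tl] := ht; rewrite mvglue_inr_pt ?itvW // ord_at_pt // ord_at_pt //.
case: eqP => [/(pt_neq_vertex ht) //|_]; rewrite add0r /kink.
by rewrite (mvglue_slope_r e t).1 ?(mvglue_slope_r e t).2 ?t0 ?tl ?ltW.
Qed.

End Function.

Lemma metric_wedge_principal :
  @wedge_principal (Metric R) G1 G2 G i1 i2 (inl w1) (inl v2).
Proof.
apply: (@wedge_principal_by (Metric R) G1 G2 G _ _ _ _ metric_wedge_maps R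
  _ _ _ _ _ _ (metric_principal_by G) (metric_principal_by G1)
  (metric_principal_by G2)).
- exact: mvglue_rational.
- exact: mvglue_ord_l.
- exact: mvglue_ord_r.
Qed.

End VertexGlue.
End MetricGlue.

Section Glue.
Variables (k : graph_kind) (G1 G2 : graph k) (w1 : points G1) (v2 : points G2).

Lemma glue_wedge : wedge_maps (glue_inl w1 v2) (glue_inr w1 v2) w1 v2 /\
  wedge_principal (glue_inl w1 v2) (glue_inr w1 v2) w1 v2.
Proof.
case: k G1 G2 w1 v2 => [|R] H1 H2 w v.
  by split; [apply: finite_wedge_maps | apply: finite_wedge_principal].
have iso1 := refinement_divisor_iso (to_model_refinement w).
have iso2 := refinement_divisor_iso (to_model_refinement v).
have wm := metric_wedge_maps (vertex_at w) (vertex_at v).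
have wp := metric_wedge_principal (vertex_at w) (vertex_at v).
rewrite -!to_model_at_vertex in wm wp.
split; [exact: wedge_maps_comp iso1 iso2 wm | exact: wedge_principal_comp iso1 iso2 wp].
Qed.

End Glue.
(** * The rank of a divisor on a vertex gluing *)

Lemma principal_group_all (k : graph_kind) (G : graph k) : principal_group G.
Proof.
by case: k G => [|R] G; [apply: finite_principal_group | apply: metric_principal_group].
Qed.

Lemma riemann_roch_witness_all (k : graph_kind) (G : graph k) (q : points G) :
  riemann_roch_witness G.
Proof.
case: k G q => [|R] G q; last exact: metric_riemann_roch_witness.
exact: (@finite_riemann_roch_witness Rdefinitions.R).
Qed.

Lemma int_cross (P : int -> Prop) (lo hi : int) :
  lo <= hi -> P lo -> ~ P hi -> exists x, P x /\ ~ P (x + 1).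
Proof.
move=> le; have [n en] : exists n : nat, hi = lo + n%:Z.
  by exists (absz (hi - lo)); lia.
rewrite {hi le}en; elim: n => [|n IH] Plo nP; first by rewrite addr0 in nP.
have [h|h] := pselect (P (lo + n%:Z)); last exact: IH.
by exists (lo + n%:Z); split=> //; rewrite -addrA (_ : n%:Z + 1 = n.+1%:Z) //; lia.
Qed.

Section WedgeRank.
Variables (k : graph_kind) (G1 G2 G : graph k).
Variables (i1 : points G1 -> points G) (i2 : points G2 -> points G).
Variables (w1 : points G1) (v2 : points G2).
Hypothesis wm : wedge_maps i1 i2 w1 v2.
Hypothesis wp : wedge_principal i1 i2 w1 v2.
Variables (D1 : divisor G1) (D2 : divisor G2).

Local Notation D := (push i1 D1 + push i2 D2).
Local Notation A l := (D1 - pdiv_mul l w1).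
Local Notation B l := (D2 + pdiv_mul l v2).

(** Each point is attributed to one of the two sides; the gluing point may go
    to either. *)
Lemma wedge_effective_split (E : divisor G) : effective E -> exists E1 E2,
  [/\ effective E1, effective E2 & E = push i1 E1 + push i2 E2].
Proof.
have [_ _ _ surj] := wm => effE.
have /choice[s hs] : forall p, exists s : points G1 + points G2,
    p = match s with inl x => i1 x | inr y => i2 y end.
  by move=> p; have [[x ->]|[y ->]] := surj p; [exists (inl x) | exists (inr y)].
exists (\sum_(p <- dom E) if s p is inl x then pdiv_mul (coeff p E) x else 0).
exists (\sum_(p <- dom E) if s p is inr y then pdiv_mul (coeff p E) y else 0).
split.
- move=> z; rewrite raddf_sum; apply: sumr_ge0 => p _ /=.
  by case: (s p) => // x; rewrite ?coeff0 //; apply: effectiveU.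
- move=> z; rewrite raddf_sum; apply: sumr_ge0 => p _ /=.
  by case: (s p) => // x; rewrite ?coeff0 //; apply: effectiveU.
rewrite !push_sum -big_split -[LHS]freeg_sumE; apply: eq_bigr => p _ /=.
rewrite [X in << _ *g X >>](hs p); case: (s p) => x; rewrite push0 pushU.
  by rewrite addr0.
by rewrite add0r.
Qed.

Lemma wedge_equiv_effective (F1 : divisor G1) (F2 : divisor G2) :
  equiv_effective (push i1 F1 + push i2 F2) <-> exists l : int,
  equiv_effective (F1 - pdiv_mul l w1) /\ equiv_effective (F2 + pdiv_mul l v2).
Proof.
split=> [[E effE pr]|[l [[E1 eff1 h1] [E2 eff2 h2]]]].
  have [E1 [E2 [eff1 eff2 eE]]] := wedge_effective_split effE.
  have /wp[l [h1 h2]] : principal (push i1 (F1 - E1) + push i2 (F2 - E2)).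
    by rewrite !pushB addrACA -opprD -eE.
  exists l; split; first by exists E1 => //; rewrite /lin_equiv addrAC.
  by exists E2 => //; rewrite /lin_equiv addrAC.
exists (push i1 E1 + push i2 E2).
  by apply: effectiveD; apply: push_effective.
have /wp : exists c : int, principal ((F1 - E1) - pdiv_mul c w1)
                        /\ principal ((F2 - E2) + pdiv_mul c v2).
  by exists l; rewrite addrAC [F2 - E2 + _]addrAC.
by rewrite !pushB addrACA -opprD.
Qed.

Let pg1 := principal_group_all G1.
Let pg2 := principal_group_all G2.
Let pg := principal_group_all G.

Lemma rank_antitone_l (m n : int) : m <= n -> rank (A n) <= rank (A m).
Proof.
move=> le; have -> : A m = A n + pdiv_mul (n - m) w1.
  by apply/eqP/freeg_eqP => z; rewrite !(coeffD, coeffN) !coeffU; ring.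
by apply: (rank_leD pg1 w1); apply: effectiveU; rewrite subr_ge0.
Qed.

Lemma rank_monotone_r (m n : int) : m <= n -> rank (B m) <= rank (B n).
Proof.
move=> le; have -> : B n = B m + pdiv_mul (n - m) v2.
  by apply/eqP/freeg_eqP => z; rewrite !(coeffD, coeffN) !coeffU; ring.
by apply: (rank_leD pg2 v2); apply: effectiveU; rewrite subr_ge0.
Qed.

(** The property holds for very negative [l] by Riemann-Roch and fails once
    the degree is negative. *)
Lemma last_rank_ge (n : nat) : exists l : int, rank_ge (A l) n /\ ~ rank_ge (A (l + 1)) n.
Proof.
have [g1 rr] := riemann_roch pg1 w1 (riemann_roch_witness_all w1).
have degA l : deg (A l) = deg D1 - l by rewrite raddfB /= degU.
have lb l : deg D1 - l - g1 - 1 <= rank (A l).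
  have := rr (A l); have := rank_geN1 pg1 w1 (canonical G1 - A l).
  by rewrite degA; lia.
pose lo := deg D1 - g1 - 1 - n%:Z; pose hi := deg D1 + 1.
apply: (@int_cross (fun l => rank_ge (A l) n) (Num.min lo hi) hi).
- by rewrite ge_min lexx orbT.
- by apply/(rank_geP pg1 w1); have := lb (Num.min lo hi); rewrite /lo; lia.
- move/(rank_geP pg1 w1); rewrite (rank_neg pg1 w1) //.
  by rewrite degA /hi; lia.
Qed.

(** For fixed degrees on both sides, the chips that the first side can send
    through the gluing point are limited by one worst effective divisor, so a
    single number of chips serves all effective divisors. *)
Lemma wedge_rank_ge (n : nat) : rank_ge D n <-> forall e1 e2 : nat, (e1 + e2)%N = n ->
  exists l : int, rank_ge (A l) e1 /\ rank_ge (B l) e2.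
Proof.
split=> [h e1 e2 en|h E effE dE].
  (* E1 is a worst divisor: it forbids to move more than l chips. *)
  have [l [hl /existsNP[E1]]] := last_rank_ge e1.
  move=> /not_implyP[eff1 /not_implyP[d1 nE1]]; exists l; split=> // E2 eff2 d2.
  have := h (push i1 E1 + push i2 E2); rewrite raddfD /= !deg_push d1 d2 -PoszD en.
  move=> /(_ (effectiveD (push_effective _ eff1) (push_effective _ eff2)) erefl).
  rewrite opprD addrACA -!pushB => /wedge_equiv_effective[c [h1 h2]].
  have [cl|lc] := lerP c l; last first.
    case: nE1; have := @equiv_effectiveD _ _ _ (pdiv_mul (c - (l + 1)) w1) _ h1.
    rewrite (_ : _ + _ = A (l + 1) - E1); first by apply; apply: effectiveU; lia.
    by apply/eqP/freeg_eqP => z; rewrite !(coeffD, coeffN) !coeffU; ring.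
  have := @equiv_effectiveD _ _ _ (pdiv_mul (l - c) v2) _ h2.
  rewrite (_ : _ + _ = B l - E2); first by apply; apply: effectiveU; lia.
  by apply/eqP/freeg_eqP => z; rewrite !(coeffD, coeffN) !coeffU; ring.
have [E1 [E2 [eff1 eff2 eE]]] := wedge_effective_split effE.
have [e1 d1] : exists e : nat, deg E1 = e%:Z.
  by exists (absz (deg E1)); have := effective_deg eff1; lia.
have [e2 d2] : exists e : nat, deg E2 = e%:Z.
  by exists (absz (deg E2)); have := effective_deg eff2; lia.
have [|l [h1 h2]] := h e1 e2.
  by move: dE; rewrite eE raddfD /= !deg_push d1 d2; lia.
rewrite eE opprD addrACA -!pushB; apply/wedge_equiv_effective; exists l.
by rewrite addrAC [D2 - E2 + _]addrAC; split; [apply: h1 | apply: h2].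
Qed.

(** Otherwise e1 = r(A l) + 1 and e2 = r(D) - e1 satisfy r(B (l - 1)) < e2, and the
    number l' of chips that serves both would have to be smaller than l and larger
    than l - 1. *)
Lemma wedge_rank_le (l : int) : rank D + 1 <= (rank (A l) + 1) + (rank (B (l - 1)) + 1).
Proof.
have := rank_geN1 pg1 w1 (A l); have := rank_geN1 pg2 v2 (B (l - 1)) => b1 a1.
case e : (rank D) => [n|n]; last by lia.
rewrite leNgt; apply/negP => lt.
have /wedge_rank_ge : rank_ge D n by apply/(rank_geP pg (i1 w1)); rewrite e.
pose e1 := absz (rank (A l) + 1); move=> /(_ e1 (n - e1)%N).
have le : (e1 <= n)%N by rewrite /e1; lia.
rewrite subnKC // => /(_ erefl)[l' [/(rank_geP pg1 w1) h1 /(rank_geP pg2 v2) h2]].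
have l'l : l' < l.
  by rewrite ltNge; apply/negP => /rank_antitone_l; move: h1; rewrite /e1; lia.
have : rank (B l') <= rank (B (l - 1)) by apply: rank_monotone_r; lia.
by move: h2; rewrite /e1 in le *; lia.
Qed.

(** Some e1 + e2 = r(D) + 1 is served by no number of chips; take the last l
    that serves e1, and the minimum is attained at l + 1. *)
Lemma wedge_rank_attained :
  exists l : int, (rank (A l) + 1) + (rank (B (l - 1)) + 1) <= rank D + 1.
Proof.
have [n en] : exists n : nat, rank D + 1 = n%:Z.
  by exists (absz (rank D + 1)); have := rank_geN1 pg (i1 w1) D; lia.
have : ~ rank_ge D n by move/(rank_geP pg (i1 w1)); lia.
move=> /wedge_rank_ge/existsNP[e1 /existsNP[e2 /not_implyP[e12 nl]]].
have [l [hl nhl]] := last_rank_ge e1; exists (l + 1); rewrite addrK en.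
have : ~ rank_ge (B l) e2 by move=> h; apply: nl; exists l.
move: nhl; rewrite (rank_geP pg1 w1) (rank_geP pg2 v2); lia.
Qed.

End WedgeRank.

Lemma starE (s1 s2 : int -> int -> nat) (a b : int) (n : nat) :
  (forall l, (n <= s1 a l + s2 l b)%N) -> (exists l, (s1 a l + s2 l b <= n)%N) ->
  star s1 s2 a b = n.
Proof.
move=> le [l hl]; rewrite /star; case: ex_minnP => m /asboolP[l' ->] mx.
apply/eqP; rewrite eqn_leq le andbT; apply: leq_trans hl; apply: mx.
by apply/asboolP; exists l.
Qed.

Lemma transmission_wedge (k : graph_kind) (G1 G2 G : graph k)
    (i1 : points G1 -> points G) (i2 : points G2 -> points G)
    (v1 w1 : points G1) (v2 w2 : points G2) (D1 : divisor G1) (D2 : divisor G2) :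
  wedge_maps i1 i2 w1 v2 -> wedge_principal i1 i2 w1 v2 ->
  transmission_function (push i1 D1 + push i2 D2) (i1 v1) (i2 w2)
  = star (transmission_function D1 v1 w1) (transmission_function D2 v2 w2).
Proof.
move=> wm wp; apply/funext => a; apply/funext => b; apply/esym.
pose F1 := D1 + pdiv_mul (a - 1) v1; pose F2 := D2 - pdiv_mul b w2.
have eF : push i1 D1 + push i2 D2 + pdiv_mul (a - 1) (i1 v1) - pdiv_mul b (i2 w2)
    = push i1 F1 + push i2 F2.
  by rewrite pushD pushB !pushU addrACA addrA.
have e2 l : D2 + pdiv_mul (l - 1) v2 - pdiv_mul b w2 = F2 + pdiv_mul (l - 1) v2.
  by rewrite addrAC.
have ge1 := rank_geN1 (principal_group_all G1) w1.
have ge2 := rank_geN1 (principal_group_all G2) v2.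
have ge := rank_geN1 (principal_group_all G) (i1 w1).
have absz_le (x y z : int) : -1 <= x -> -1 <= y -> -1 <= z ->
    x + 1 <= (y + 1) + (z + 1) -> (absz (x + 1)%R <= absz (y + 1)%R + absz (z + 1)%R)%N.
  by lia.
have absz_ge (x y z : int) : -1 <= x -> -1 <= y -> -1 <= z ->
    (y + 1) + (z + 1) <= x + 1 -> (absz (y + 1)%R + absz (z + 1)%R <= absz (x + 1)%R)%N.
  by lia.
apply: starE => [l|]; last have [l hl] := wedge_rank_attained wm wp F1 F2.
  by rewrite /transmission_function eF e2; apply: absz_le => //; apply: wedge_rank_le.
by exists l; rewrite /transmission_function eF e2; apply: absz_ge.
Qed.

(** * Transmission permutations *)

Lemma is_card0 (A : set int) : (forall x, ~ A x) -> is_card A 0.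
Proof.
move=> h; have -> : A = set0 by apply/seteqP; split=> x // /h.
by split; [apply: finite_set0 | rewrite fset_set0 cardfs0].
Qed.

Lemma is_cardU1 (A B : set int) (x z : int) : is_card A z -> ~ A x ->
  (forall y, B y <-> y = x \/ A y) -> is_card B (z + 1).
Proof.
move=> [finA ->] nA eB; have -> : B = (x |` A)%classic by apply/seteqP; split=> y /eB.
split; first by rewrite finite_setU; split=> //; apply: finite_set1.
rewrite fset_setU1 // cardfsU1 in_fset_set //.
by rewrite (_ : x \notin A) ?add1n; [lia | apply/negP => /set_mem].
Qed.

Section PermutationOfSubmodular.
Variables (s s' : int -> int -> int) (C N : int).
Hypothesis duality : forall a b, s a b - s' a b = a - b + C.
Hypothesis s_eq0 : forall a b : int, a - b < - N -> s a b = 0.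
Hypothesis s'_eq0 : forall a b : int, N < a - b -> s' a b = 0.
Hypothesis step_a : forall a b, s a b - 1 <= s (a - 1) b <= s a b.
Hypothesis step_b : forall a b, s a b - 1 <= s a (b + 1) <= s a b.
Hypothesis submod : forall a b,
  0 <= s a b - s (a - 1) b - s a (b + 1) + s (a - 1) (b + 1).

Let row_mono (a a' b : int) : a <= a' -> s a b - s a (b + 1) <= s a' b - s a' (b + 1).
Proof.
move=> le; have [n ->] : exists n : nat, a' = a + n%:Z.
  by exists (absz (a' - a)); lia.
elim: n => [|n IH]; first by rewrite addr0.
apply: le_trans IH _; have := submod (a + n.+1%:Z) b.
by rewrite (_ : a + n.+1%:Z - 1 = a + n%:Z); lia.
Qed.

Let col_mono (a b b' : int) : b <= b' -> s a b' - s (a - 1) b' <= s a b - s (a - 1) b.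
Proof.
move=> le; have [n ->] : exists n : nat, b' = b + n%:Z.
  by exists (absz (b' - b)); lia.
elim: n => [|n IH]; first by rewrite addr0.
apply: le_trans IH; have := submod a (b + n%:Z).
by rewrite (_ : b + n.+1%:Z = b + n%:Z + 1); lia.
Qed.

(** A first difference of [s] in one variable is 0 or 1 and monotone in the
    other variable, so it switches at exactly one place. *)
Let row_jump (b : int) : exists t : int, forall a : int,
  (t <= a)%R = (s a b - s a (b + 1) == 1).
Proof.
pose lo := Num.min (b - N - 1) (b + N + 2); pose hi := b + N + 2.
have [|||t [ht nt]] := @int_cross (fun a => s a b - s a (b + 1) = 0) lo hi.
- by rewrite ge_min lexx orbT.
- by rewrite !s_eq0 //; rewrite /lo; lia.
- have := duality hi b; have := duality hi (b + 1).
  by rewrite !s'_eq0 /hi; lia.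
have := step_b (t + 1) b => h1.
exists (t + 1) => a; have := step_b a b; have [le|lt] := lerP (t + 1) a.
  have := row_mono b le; move: nt h1; lia.
have := @row_mono a t b; move: ht; lia.
Qed.

Let col_jump (a : int) : exists t : int, forall b : int,
  (b <= t)%R = (s a b - s (a - 1) b == 1).
Proof.
pose lo := Num.min (a - N - 2) (a + N + 1); pose hi := a + N + 1.
have [|||t [ht nt]] := @int_cross (fun b => s a b - s (a - 1) b = 1) lo hi.
- by rewrite ge_min lexx orbT.
- have := duality a lo; have := duality (a - 1) lo.
  by rewrite !s'_eq0 /lo; lia.
- by rewrite !s_eq0 //; rewrite /hi; lia.
have := step_a a (t + 1) => h1.
exists t => b; have := step_a a b; have [le|lt] := lerP b t.
  have := col_mono a le; move: ht; lia.
have := @col_mono a (t + 1) b; move: nt h1; lia.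
Qed.

(** The permutation sends b to the place where s a b - s a (b + 1) becomes 1;
    its inverse sends a to the last place where s a b - s (a - 1) b is 1.  They are
    inverse to each other because both record where the mixed difference is 1.
    The counts follow by induction on [b], starting where [s], respectively [s'],
    vanishes. *)
Lemma submodular_permutation : exists tau : int -> int, bijective tau /\
  forall a b, is_card [set n | b <= n /\ tau n <= a]%classic (s a b) /\
    is_card [set n | n < b /\ a < tau n]%classic (s' a b).
Proof.
have /choice[tau htau] := row_jump; have /choice[sigma hsigma] := col_jump.
exists tau; split.
  exists sigma => [b|a].
    have := htau b (tau b); have := htau b (tau b - 1).
    have := hsigma (tau b) b; have := hsigma (tau b) (b + 1).
    have := step_a (tau b) b; have := step_a (tau b) (b + 1); lia.
  have := hsigma a (sigma a); have := hsigma a (sigma a + 1).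
  have := htau (sigma a) a; have := htau (sigma a) (a - 1).
  have := step_b a (sigma a); have := step_b (a - 1) (sigma a); lia.
move=> a b; split.
  pose b0 := Num.max b (a + N + 1).
  have b0E : a + N + 1 <= b0 by rewrite le_max lexx orbT.
  have [m em] : exists m : nat, b = b0 - m%:Z.
    have : b <= b0 by rewrite le_max lexx.
    by exists (absz (b0 - b)); lia.
  rewrite {}em; move: b0 b0E => {}b b0E.
  elim: m => [|m IH].
    rewrite subr0 s_eq0; last by lia.
    by apply: is_card0 => n [bn]; rewrite htau !s_eq0 //; lia.
  set c := b - m.+1%:Z; have ec : b - m%:Z = c + 1 by rewrite /c; lia.
  rewrite ec in IH; have := step_b a c; have := htau c a.
  have [le /esym/eqP e _|lt /esym/eqP ne st] := lerP (tau c) a.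
    rewrite (_ : s a c = s a (c + 1) + 1); last by lia.
    apply: (is_cardU1 (x := c) IH) => [/= [h _]|y /=]; first by lia.
    split=> [[cy ty]|[->|[cy ty]]]; [|split; lia|split; lia].
    by have [->|ne] := eqVneq y c; [left | right; split=> //; move: ne; lia].
  rewrite (_ : s a c = s a (c + 1)); last by lia.
  rewrite (_ : [set n | c <= n /\ _]%classic = [set n | c + 1 <= n /\ tau n <= a]%classic) //.
  apply/seteqP; split=> y /= [cy ty]; split=> //; last by lia.
  by have : y != c; [apply: contraTneq ty => ->; rewrite -ltNge | lia].
pose b0 := Num.min b (a - N - 1).
have b0E : b0 <= a - N - 1 by rewrite ge_min lexx orbT.
have [m em] : exists m : nat, b = b0 + m%:Z.
  have : b0 <= b by rewrite ge_min lexx.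
  by exists (absz (b0 - b)); lia.
rewrite {}em; move: b0 b0E => {}b b0E.
elim: m => [|m IH].
  rewrite addr0 s'_eq0; last by lia.
  apply: is_card0 => n [nb]; rewrite ltNge htau; apply/negP/negPn/eqP.
  have := duality a n; have := duality a (n + 1).
  by rewrite !s'_eq0; lia.
set c := b + m%:Z; have ec : b + m.+1%:Z = c + 1 by rewrite /c; lia.
rewrite ec -/c in IH *; have := step_b a c; have := htau c a.
have := duality a c; have := duality a (c + 1).
have [le d1 d2 /esym/eqP e _|lt d1 d2 /esym/eqP ne st] := lerP (tau c) a.
  rewrite (_ : s' a (c + 1) = s' a c); last by lia.
  rewrite (_ : [set n | n < c + 1 /\ _]%classic = [set n | n < c /\ a < tau n]%classic) //.
  apply/seteqP; split=> y /= [cy ty]; split=> //; last by lia.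
  by have : y != c; [apply: contraTneq ty => ->; rewrite -leNgt | lia].
rewrite (_ : s' a (c + 1) = s' a c + 1); last by lia.
apply: (is_cardU1 (x := c) IH) => [/= [h _]|y /=]; first by lia.
split=> [[cy ty]|[->|[cy ty]]]; [|split; lia|split; lia].
by have [->|ne'] := eqVneq y c; [left | right; split=> //; move: ne'; lia].
Qed.

End PermutationOfSubmodular.

Lemma transmission_permutation_exists (k : graph_kind) (G : graph k)
    (D : divisor G) (v w : points G) : submodular D v w ->
  exists tau, is_transmission_permutation D v w tau.
Proof.
move=> sub; have pg := principal_group_all G.
have [g1 rr] := riemann_roch pg v (riemann_roch_witness_all v).
pose E a b := D + pdiv_mul a v - pdiv_mul b w.
pose E' a b := canonical G - D - pdiv_mul a v + pdiv_mul b w.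
have EE' a b : E' a b = canonical G - E a b.
  by rewrite /E /E'; apply/eqP/freeg_eqP => z; rewrite !(coeffD, coeffN); ring.
have dE a b : deg (E a b) = deg D + a - b by rewrite raddfB raddfD /= !degU.
have dE' a b : deg (E' a b) = deg (canonical G) - (deg D + a - b).
  by rewrite EE' raddfB /= dE.
have Ea a b : E (a - 1) b = E a b - pdiv_mul 1 v.
  by apply/eqP/freeg_eqP => z; rewrite !(coeffD, coeffN) !coeffU; ring.
have Eb a b : E a (b + 1) = E a b - pdiv_mul 1 w.
  by apply/eqP/freeg_eqP => z; rewrite !(coeffD, coeffN) !coeffU; ring.
pose N := `|deg D| + `|deg (canonical G)|.
have [||||||tau [bij htau]] := @submodular_permutation
    (fun a b => rank (E a b) + 1) (fun a b => rank (E' a b) + 1) (deg D - g1) N.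
- by move=> a b; have := rr (E a b); rewrite dE EE'; lia.
- by move=> a b h; rewrite (rank_neg pg v) // dE; move: h; rewrite /N; lia.
- by move=> a b h; rewrite (rank_neg pg v) // dE'; move: h; rewrite /N; lia.
- move=> a b; rewrite Ea; have := rank_subU_le pg v (E a b) v.
  by have := rank_subU_ge pg v (E a b) v; lia.
- move=> a b; rewrite Eb; have := rank_subU_le pg v (E a b) w.
  by have := rank_subU_ge pg v (E a b) w; lia.
- move=> a b; have := sub a b; rewrite /Delta -/(E a b) !Eb !Ea; lia.
by exists tau.
Qed.

Lemma s_perm_transmission (k : graph_kind) (G : graph k) (D : divisor G)
    (v w : points G) (tau : int -> int) : is_transmission_permutation D v w tau ->
  s_perm tau = transmission_function D v w.
Proof.
move=> [_ h]; apply/funext => a; apply/funext => b.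
have [[fin e] _] := h (a - 1) b; rewrite /transmission_function e /s_perm /=.
congr (#|` fset_set _|); apply/seteqP; split=> n /= [h1 h2]; split=> //; lia.
Qed.

Lemma transmission_almost_sign_preserving (k : graph_kind) (G : graph k)
    (D : divisor G) (v w : points G) (tau : int -> int) :
  is_transmission_permutation D v w tau -> almost_sign_preserving tau.
Proof.
move=> [[tauV K1 K2] h]; exists tauV; split=> //.
  have [[fin _] _] := h (-1) 0; apply: sub_finite_set fin => n /= [h1 h2].
  by split=> //; lia.
have [_ [fin _]] := h (-1) 0.
apply: (sub_finite_set _ (finite_image tau fin)) => n /= [h1 h2].
by exists (tauV n); [split=> //; rewrite K2; lia | rewrite K2].
Qed.

Theorem theorem3p11 (k : graph_kind) (G1 G2 : graph k)
    (v1 w1 : points G1) (v2 w2 : points G2)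
    (D1 : divisor G1) (D2 : divisor G2) :
  let v : points (glue w1 v2) := glue_inl w1 v2 v1 in
  let w : points (glue w1 v2) := glue_inr w1 v2 w2 in
  let D : divisor (glue w1 v2) :=
    push (glue_inl w1 v2) D1 + push (glue_inr w1 v2) D2 in
  transmission_function D v w
    = star (transmission_function D1 v1 w1) (transmission_function D2 v2 w2)
  /\ (submodular D1 v1 w1 -> submodular D2 v2 w2 -> submodular D v w ->
      exists tau1 tau2 tau : int -> int,
        [/\ is_transmission_permutation D1 v1 w1 tau1,
            is_transmission_permutation D2 v2 w2 tau2,
            is_transmission_permutation D v w tau &
            is_demazure_product tau1 tau2 tau]).
Proof.
move=> v w D; have [wm wp] := glue_wedge w1 v2.
have E := transmission_wedge v1 w2 D1 D2 wm wp; split=> // sub1 sub2 sub.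
have [tau1 h1] := transmission_permutation_exists sub1.
have [tau2 h2] := transmission_permutation_exists sub2.
have [tau h] := transmission_permutation_exists sub.
exists tau1, tau2, tau; split=> //; split.
- exact: transmission_almost_sign_preserving h1.
- exact: transmission_almost_sign_preserving h2.
- exact: transmission_almost_sign_preserving h.
by rewrite (s_perm_transmission h1) (s_perm_transmission h2) (s_perm_transmission h).
Qed.
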